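(* Let $\mathbb{F}_q$ be a finite field with $q$ elements and let $\psi$ be a nontrivial additive character of $\mathbb{F}_q$. For each $f\in\mathbb{F}_q[x]$, define $\varphi_f\in\mathbb{C}^q$ (regarded as the space of functions $\mathbb{F}_q\to\mathbb{C}$) by \[ \varphi_f(x)=\frac{1}{\sqrt q}\,\psi(f(x))\qquad\forall x\in\mathbb{F}_q . \] For each positive integer $r<\operatorname{char}(\mathbb{F}_q)$, let $S(r)$ denote the set of $f\in\mathbb{F}_q[x]$ with $f(0)=0$ and $\deg(f)\le r$. Then: (a) $S(1)\subseteq S(2)\subseteq\cdots\subseteq S(\operatorname{char}(\mathbb{F}_q)-1)$, and each $\{\varphi_f\}_{f\in S(r)}$ is formed by $q^r$ vectors in $\mathbb{C}^q$. (b) $\{\varphi_f\}_{f\in S(1)}$ is formed by the additive characters of $\mathbb{F}_q$, each scaled by $1/\sqrt q$. (c) If $2<\operatorname{char}(\mathbb{F}_q)$, then $\{\varphi_f\}_{f\in S(2)}$ gives $q$ bases in $\mathbb{C}^q$ (i.e., it can be partitioned into $q$ orthonormal bases) that, together with the identity basis, are mutually unbiased. (d) For every positive integer $r<\operatorname{char}(\mathbb{F}_q)$, $|\langle\varphi_f,\varphi_g\rangle|\le (r-1)/\sqrt q$ for all $f,g\in S(r)$ with $f\ne g$.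
   Context: An additive character of $\mathbb{F}_q$ is a group homomorphism $\psi\colon(\mathbb{F}_q,+)\to\{z\in\mathbb{C}:|z|=1\}$; it is nontrivial if it is not identically $1$. The inner product on $\mathbb{C}^q$ is the standard Hermitian one. The identity basis is the standard basis of $\mathbb{C}^q$. A collection of orthonormal bases of $\mathbb{C}^q$ is mutually unbiased if $|\langle x,y\rangle|=1/\sqrt q$ whenever $x$ and $y$ belong to different bases in the collection. The zero polynomial belongs to every $S(r)$. *)

(* Defs.v *)
From mathcomp Require Import all_boot all_order all_algebra.
From mathcomp Require Import classical_sets functions cardinality reals.
From mathcomp.real_closed Require Export complex.

Set Implicit Arguments.
Unset Strict Implicit.
Unset Printing Implicit Defensive.

Import Order.TTheory GRing.Theory Num.Theory.

Local Open Scope classical_set_scope.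
Local Open Scope ring_scope.

Section Defs.
Variables (R : realType) (F : finFieldType).

(* The space C^q of functions F -> C. The regular algebra R[i]^o (the field of
   complex numbers seen as a vector space over itself) gives this type
   its R[i]-vector space structure. *)
Definition cvec : vectType R[i] := {ffun F -> R[i]^o}.

(* The nonnegative square root of q, as an element of R[i]. *)
Definition sqrtq : R[i] := sqrtC (#|F|%:R).

Definition additive_character (psi : F -> R[i]) : Prop :=
  {morph psi : x y / x + y >-> x * y} /\ forall x, `|psi x| = 1.

Definition nontrivial_character (psi : F -> R[i]) : Prop :=
  exists x, psi x <> 1.

Definition scaled (chi : F -> R[i]) : cvec := [ffun x => sqrtq^-1 * chi x].

Definition phi (psi : F -> R[i]) (f : {poly F}) : cvec :=
  scaled (fun x => psi f.[x]).

(* [size f] is deg f + 1, and 0 for the zero polynomial. *)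
Definition Spoly (r : nat) : set {poly F} :=
  [set f | f.[0] = 0 /\ (size f <= r.+1)%N].

Definition inner (u v : cvec) : R[i] := \sum_(x : F) (u x : R[i]) * (v x)^*.

Definition orthonormal_basis (A : set cvec) : Prop :=
  exists s : #|F|.-tuple cvec,
    [/\ A = [set` s],
        basis_of fullv s &
        forall i j, inner (tnth s i) (tnth s j) = (i == j)%:R].

Definition identity_basis : set cvec :=
  range (fun a : F => [ffun x => (x == a)%:R] : cvec).

Definition mutually_unbiased (I : Type) (B : I -> set cvec) : Prop :=
  (forall i, orthonormal_basis (B i)) /\
  forall i j, i <> j ->
    forall x y, B i x -> B j y -> `|inner x y| = 1 / sqrtq.

End Defs.

Arguments Spoly F r : clear implicits.
Arguments identity_basis R F : clear implicits.

(* Main.v *)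
Require Import Defs.
From HB Require Import structures.
From mathcomp Require Import all_boot all_order all_algebra all_field.
From mathcomp Require Import classical_sets functions cardinality reals.
From mathcomp Require Import zify ring.

(** Part (d) is Weil's bound: if [h] has degree [d] with [0 < d < char F], then
    the sum of [psi h.[x]] over [F] has modulus at most [(d - 1) * sqrt q].  It
    is applied to [h = f - g], because the inner product of [phi f] and [phi g]
    is [1 / q] times that sum.  The proof combines the rationality
    of the L-function with Stepanov's method.

    From here on [f] is any polynomial of degree [d] with [0 < d < char F].  Let
    [K] be an algebraic closure of [F], and let [S_n] be the sum of
    [psi (Tr (f.[x]))] over the subfield of [K] with [q ^ n] elements, [Tr]
    being its trace to [F].  Extend [psi] to monic polynomials [g] over [F], as
    [psi] of the sum of [f] over the roots of [g]; this is multiplicative in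
    [g].  Let [D_n] be its sum over the monic [g] of degree [n].
    - [D_n = 0] for [n >= d] ([Lcoef_eq0]): adding [c * X ^ (n - d)] to [g]
      keeps the power sums of its roots of index below [d] and moves the [d]-th
      by [- c * d], so it multiplies the summand by an arbitrary value of [psi].
    - [n * D_n] is the sum of [S_k * D_(n - k)] over [0 < k <= n]
      ([Lcoef_recurrence]): this counts each root of [g] through the Frobenius
      orbit that contains it.
    Newton's identities have the same shape as this recurrence, so there are
    [d - 1] complex numbers [w] such that [S_n] is minus the sum of the
    [w ^ n] ([char_sum_power_sum]).  It remains to see that [|w| <= sqrt q],
    and for that any bound [|S_n| <= c * sqrt q ^ n] with [c] independent of
    [n] is enough ([power_sum_growth]).

    Such a bound follows from an upper bound for the number of [x] in the field
    with [q ^ n] elements where [Tr (f.[x])] takes a given value [a]: as these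
    numbers add up to [q ^ n], upper bounds that are nearly sharp for every [a]
    also bound each of them from below ([char_sum_bound]).  The upper bound
    ([stepanov_bound]) comes from a nonzero polynomial of small degree that
    vanishes to high order at all these [x]; it is found by counting the
    unknowns and the equations of a linear system.

    For the other parts: two polynomials of degree less than [char F] without
    constant term give the same vector only if they are equal, since a finite
    difference lowers the degree by exactly one ([character_const_poly]); every
    character has the form [psi (c * x)], since a character cannot be
    orthogonal to all of these ([phi_linear_characters]); and the quadratic
    Gauss sums that decide unbiasedness have modulus exactly [sqrt q]
    ([quadratic_sum_norm]).  For a fixed [a], the vectors of the polynomials
    [a * X ^ 2 + b * X] form one of the [q] bases. *)

Set Implicit Arguments.
Unset Strict Implicit.
Unset Printing Implicit Defensive.

Import Order.TTheory GRing.Theory Num.Theory.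

Local Open Scope ring_scope.

(** * Newton's identities *)

Section Newton.
Variable R : comNzRingType.
Implicit Types (rs : seq R) (n : nat).

(** This is the reversed polynomial of the product of the [X - a]; reversed,
    the coefficient of index [i] does not depend on the number of roots. *)
Definition recip_poly rs : {poly R} := \prod_(a <- rs) (1 - a *: 'X).

Definition power_sum rs k : R := \sum_(a <- rs) a ^+ k.

Lemma recip_poly_cons a rs :
  recip_poly (a :: rs) = recip_poly rs - a *: (recip_poly rs * 'X).
Proof.
by rewrite /recip_poly big_cons mulrBl mul1r -scalerAl [_ * 'X]mulrC.
Qed.

Lemma coef0_recip_poly rs : (recip_poly rs)`_0 = 1.
Proof.
elim: rs => [|a rs IH]; first by rewrite /recip_poly big_nil coef1.
by rewrite recip_poly_cons coefB coefZ coefMX /= IH mulr0 subr0.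
Qed.

Lemma coefS_recip_poly_cons a rs n :
  (recip_poly (a :: rs))`_n.+1 = (recip_poly rs)`_n.+1 - a * (recip_poly rs)`_n.
Proof. by rewrite recip_poly_cons coefB coefZ coefMX. Qed.

(** Adding a root [a] multiplies the reversed polynomial by [1 - a X]; the
    terms [a ^ k] that enter the power sums then telescope, and what is left is
    the identity for the old roots in degrees [n] and [n - 1]. *)
Lemma newton_identity rs n :
  (recip_poly rs)`_n *+ n =
  - \sum_(k < n) power_sum rs k.+1 * (recip_poly rs)`_(n - k.+1).
Proof.
elim: rs n => [|a rs IH] [|n]; rewrite ?big_ord0 ?mulr0n ?oppr0 //.
  rewrite /recip_poly !big_nil coef1 mul0rn big1 ?oppr0 // => k _.
  by rewrite /power_sum big_nil mul0r.
rewrite coefS_recip_poly_cons mulrnBl IH.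
set e := fun i => (recip_poly rs)`_i.
have tele : \sum_(k < n.+1) a ^+ k.+1 * (recip_poly (a :: rs))`_(n.+1 - k.+1)
   = a * e n.
  have step m : \sum_(k < m.+1) a ^+ k.+1 * (recip_poly (a :: rs))`_(m - k)
      = a * e m.
    elim: m => [|m IHm].
      by rewrite big_ord_recl big_ord0 addr0 subn0 /e !coef0_recip_poly expr1.
    rewrite big_ord_recl subn0 coefS_recip_poly_cons expr1.
    rewrite (eq_bigr (fun k : 'I_m.+1 =>
      a * (a ^+ k.+1 * (recip_poly (a :: rs))`_(m - k)))); last first.
      by move=> k _; rewrite lift0 subSS exprS mulrA.
    by rewrite -mulr_sumr IHm mulrBr subrK.
  by rewrite -step; apply: eq_bigr => k _; rewrite subSS.
have -> : \sum_(k < n.+1)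
    power_sum (a :: rs) k.+1 * (recip_poly (a :: rs))`_(n.+1 - k.+1)
  = a * e n + \sum_(k < n.+1)
      power_sum rs k.+1 * (recip_poly (a :: rs))`_(n.+1 - k.+1).
  rewrite -tele -big_split; apply: eq_bigr => k _ /=.
  by rewrite {1}/power_sum big_cons mulrDl.
have -> : \sum_(k < n.+1)
      power_sum rs k.+1 * (recip_poly (a :: rs))`_(n.+1 - k.+1)
  = \sum_(k < n.+1) power_sum rs k.+1 * e (n.+1 - k.+1)%N
    - a * \sum_(k < n) power_sum rs k.+1 * e (n - k.+1)%N.
  rewrite !big_ord_recr /= !subnn coef0_recip_poly /e coef0_recip_poly.
  rewrite -addrAC; congr (_ + _).
  rewrite mulr_sumr -sumrB; apply: eq_bigr => k _.
  have -> : (n.+1 - k.+1 = (n - k.+1).+1)%N by rewrite subSS subnSK.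
  by rewrite coefS_recip_poly_cons mulrBr mulrCA.
have := congr1 (fun x => a * x) (IH n).
rewrite mulrN mulrSr -mulrnAr => ->.
by rewrite !opprD !opprK addrA addrC.
Qed.

Lemma power_sum_coef_eq rs rs' d :
    (forall i, (i <= d)%N -> (recip_poly rs)`_i = (recip_poly rs')`_i) ->
  forall k, (0 < k <= d)%N -> power_sum rs k = power_sum rs' k.
Proof.
move=> h; elim/ltn_ind => -[//|k] IH /= kd.
have := newton_identity rs k.+1; rewrite h // newton_identity => /oppr_inj.
rewrite !big_ord_recr /= subnn !coef0_recip_poly !mulr1.
rewrite (eq_bigr (fun i : 'I_k =>
   power_sum rs i.+1 * (recip_poly rs)`_(k.+1 - i.+1))) => [/addrI-> //|i _].
rewrite -IH ?ltnS //= ?(ltn_trans _ kd) ?ltnS // ?(leq_trans _ (ltnW kd)) //.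
by rewrite h // (leq_trans (leq_subr _ _)).
Qed.

(** In the [d]-th identity the [d]-th coefficient occurs with factor [d] and
    the [d]-th power sum with factor [1], while everything else involves lower
    indices only. *)
Lemma power_sum_coef_shift rs rs' d c : (0 < d)%N ->
    (forall i, (i < d)%N -> (recip_poly rs)`_i = (recip_poly rs')`_i) ->
    (recip_poly rs')`_d = (recip_poly rs)`_d + c ->
  power_sum rs' d = power_sum rs d - c *+ d.
Proof.
case: d => // d _ h hd.
have := newton_identity rs' d.+1; rewrite hd mulrnDl newton_identity.
rewrite !big_ord_recr /= subnn !coef0_recip_poly !mulr1.
rewrite (eq_bigr (fun i : 'I_d =>
   power_sum rs' i.+1 * (recip_poly rs')`_(d.+1 - i.+1))); last first.
  move=> i _; rewrite (@power_sum_coef_eq rs rs' d) ?ltn_ord //.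
  by rewrite h // subSS ltnS leq_subr.
set s := \sum_(i < d) _ => e.
have : - (power_sum rs d.+1 - c *+ d.+1) = - power_sum rs' d.+1.
  by apply: (addrI (- s)); rewrite -[RHS]opprD -e !opprD opprK addrA.
by move/oppr_inj.
Qed.

Lemma size_recip_poly rs : (size (recip_poly rs) <= (size rs).+1)%N.
Proof.
elim: rs => [|a rs IH]; first by rewrite /recip_poly big_nil size_poly1.
rewrite recip_poly_cons (leq_trans (size_polyD _ _)) // geq_max.
rewrite (leq_trans IH) //= size_polyN (leq_trans (size_scale_leq _ _)) //.
by rewrite (leq_trans (size_polyMleq _ _)) // size_polyX addn2 /= ltnS.
Qed.

Lemma coef_recip_poly rs i : (i <= size rs)%N ->
  (recip_poly rs)`_i = (\prod_(a <- rs) ('X - a%:P))`_(size rs - i).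
Proof.
elim: rs i => [|a rs IH] i /=.
  by rewrite leqn0 => /eqP->; rewrite coef0_recip_poly big_nil coef1.
rewrite big_cons mulrBl coefB coefXM coefCM.
case: i => [|i] ile.
  rewrite coef0_recip_poly subn0 /= [X in _ = _ - _ * X]nth_default.
    by have := IH 0 isT; rewrite coef0_recip_poly subn0 => <-;
      rewrite mulr0 subr0.
  by rewrite size_prod_XsubC.
rewrite coefS_recip_poly_cons subSS -IH // subn_eq0.
move: ile; rewrite leq_eqVlt eqSS => /orP [/eqP->|ile].
  by rewrite leqnn nth_default // size_recip_poly.
by rewrite leqNgt [(i < size rs)%N]ile /= IH // subnS.
Qed.
End Newton.

(** * Polynomials fixed by Frobenius *)

Definition roots_of (K : closedFieldType) (p : {poly K}) : seq K :=
  sval (closed_field_poly_normal p).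

Lemma roots_ofE (K : closedFieldType) (p : {poly K}) :
  p \is monic -> p = \prod_(z <- roots_of p) ('X - z%:P).
Proof.
move=> pm; rewrite /roots_of; case: (closed_field_poly_normal p) => r /= {1}->.
by rewrite (monicP pm) scale1r.
Qed.

Lemma size_roots_of (K : closedFieldType) (p : {poly K}) :
  p \is monic -> size p = (size (roots_of p)).+1.
Proof. by move/roots_ofE => {1}->; rewrite size_prod_XsubC. Qed.

Lemma prod_XsubC_dvdp_mup (K : fieldType) (s : seq K) (g : {poly K}) : g != 0 ->
  (forall x, (count_mem x s <= mup x g)%N) ->
  \prod_(z <- s) ('X - z%:P) %| g.
Proof.
elim: s g => [|z s IH] g g0 h; first by rewrite big_nil dvd1p.
have /dvdpP[g' Dg] : ('X - z%:P) %| g.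
  by rewrite XsubC_dvd // (leq_trans _ (h z)) //= eqxx.
have g'0 : g' != 0 by apply: contraNneq g0 => g'0; rewrite Dg g'0 mul0r.
rewrite big_cons Dg mulrC dvdp_mul // IH // => x.
have := h x; rewrite Dg mupM ?polyXsubC_eq0 // -['X - _]expr1 mup_XsubCX /=.
by case: (z == x); rewrite ?addn0 // addnC !addn1 ltnS.
Qed.

(** The proof [hq] is an argument so that the function can carry its structure
    of ring morphism, for which additivity depends on [hq]. *)
Definition frob (K : comNzRingType) q (hq : [pchar K].-nat q) (x : K) := x ^+ q.

Section FrobInst.
Variables (K : comNzRingType) (q : nat) (hq : [pchar K].-nat q).
Let frob0 : frob hq 0 = 0.
Proof. by rewrite /frob expr0n; case: q hq. Qed.
Let frobD : {morph frob hq : x y / x + y}.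
Proof. by move=> x y; rewrite /frob exprDn_pchar. Qed.
HB.instance Definition _ :=
  GRing.isNmodMorphism.Build K K (frob hq) (conj frob0 frobD).
Let frobM : {morph frob hq : x y / x * y}.
Proof. by move=> x y; rewrite /frob exprMn. Qed.
Let frob1 : frob hq 1 = 1. Proof. by rewrite /frob expr1n. Qed.
HB.instance Definition _ :=
  GRing.isMonoidMorphism.Build K K (frob hq) (conj frob1 frobM).
End FrobInst.

Section Fixed.
Variables (K : closedFieldType) (q : nat) (hq : [pchar K].-nat q).
Hypothesis q_gt1 : (1 < q)%N.
Local Notation "x ^phi" := (frob hq x) (at level 2).
Implicit Types (x y : K) (p g h : {poly K}).

Lemma frobX x i : x ^+ (q ^ i) ^+ q = x ^+ (q ^ i.+1).
Proof. by rewrite -exprM expnSr. Qed.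

Lemma exprq_inj i : injective (fun x : K => x ^+ (q ^ i)).
Proof.
move=> x y /= e; have hqi : [pchar K].-nat (q ^ i)%N by rewrite pnatX hq.
exact: (fmorph_inj (frob hqi)).
Qed.

(** For [n > 0], the subfield with [q ^ n] elements. *)
Definition Fq n : seq K := roots_of ('X^(q ^ n) - 'X).

Lemma monic_genpoly Q : (1 < Q)%N -> ('X^Q - 'X : {poly K}) \is monic.
Proof.
move=> Q1; rewrite monicE lead_coefDl ?lead_coefXn //.
by rewrite size_polyN size_polyX size_polyXn ltnS.
Qed.

Lemma expq_gt1 n : (0 < n)%N -> (1 < q ^ n)%N.
Proof. by move=> n0; rewrite -{1}(exp1n n) ltn_exp2r. Qed.

Lemma mem_Fq n x : (0 < n)%N -> (x \in Fq n) = (x ^+ (q ^ n) == x).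
Proof.
move=> n0; rewrite -root_prod_XsubC -roots_ofE ?monic_genpoly ?expq_gt1 //.
by rewrite /root !hornerE subr_eq0.
Qed.

Lemma size_Fq n : (0 < n)%N -> size (Fq n) = (q ^ n)%N.
Proof.
move=> n0; apply: succn_inj.
rewrite -size_roots_of ?monic_genpoly ?expq_gt1 //.
by rewrite size_polyDl size_polyXn // size_polyN size_polyX ltnS expq_gt1.
Qed.

Lemma pchar_nat_eq0 : q%:R = 0 :> K.
Proof.
have [r prr rq] : exists2 r, prime r & (r %| q)%N.
  by exists (pdiv q); rewrite ?pdiv_prime ?pdiv_dvd.
have rK : r \in [pchar K] by apply: (pnatPpi hq);
  rewrite mem_primes prr rq ltnW.
by case/dvdnP: rq => k ->; rewrite natrM (pcharf0 rK) mulr0.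
Qed.

(** The derivative of [X ^ (q ^ n) - X] is [-1]. *)
Lemma uniq_Fq n : (0 < n)%N -> uniq (Fq n).
Proof.
move=> n0; rewrite -separable_prod_XsubC -roots_ofE ?monic_genpoly ?expq_gt1 //.
rewrite unlock derivB derivXn derivX -(prednK n0) expnS -mulr_natr.
rewrite natrM -polyC_natr pchar_nat_eq0 polyC0 mul0r mulr0 sub0r.
by rewrite -(scaleN1r (1 : {poly K})) coprimepZr ?oppr_eq0 ?oner_eq0 ?coprimep1.
Qed.

(** Since the elements of [K] fixed by Frobenius form the field with [q]
    elements, these are the polynomials over that field. Describing them inside
    [{poly K}] makes products and quotients with orbit polynomials available
    without descending to the small field. *)
Definition fixedp p := map_poly (frob hq) p == p.

Lemma fixedpM p g : fixedp p -> fixedp g -> fixedp (p * g).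
Proof. by rewrite /fixedp rmorphM /= => /eqP-> /eqP->. Qed.

Lemma fixedp_divr p g : p != 0 -> fixedp p -> fixedp (p * g) -> fixedp g.
Proof.
by rewrite /fixedp rmorphM /= => p0 /eqP-> /eqP /(mulfI p0)->.
Qed.

Lemma fixedp_horner p x : fixedp p -> p.[x] ^+ q = p.[x ^+ q].
Proof. by move/eqP=> e; have /= := horner_map (frob hq) p x; rewrite e. Qed.

Lemma fixedp_hornerX p x i : fixedp p -> p.[x] ^+ (q ^ i) = p.[x ^+ (q ^ i)].
Proof.
move=> hp; elim: i => [|i IH]; first by rewrite !expr1.
by rewrite -[LHS]frobX IH fixedp_horner // frobX.
Qed.

Lemma fixedp_perm p : p \is monic -> fixedp p ->
  perm_eq (map (frob hq) (roots_of p)) (roots_of p).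
Proof.
move=> pm /eqP pf; apply: prod_XsubC_eq; rewrite -roots_ofE // -{}[RHS]pf.
rewrite [in RHS](roots_ofE pm) rmorph_prod big_map; apply: eq_bigr => x _ /=.
by rewrite rmorphB /= map_polyX map_polyC.
Qed.

Fixpoint monics n : seq {poly K} :=
  if n is n'.+1 then [seq g * 'X + c%:P | g <- monics n', c <- Fq 1]
  else [:: 1].

Lemma mem_monics n p :
  (p \in monics n) = [&& p \is monic, size p == n.+1 & fixedp p].
Proof.
elim: n p => [|n IH] p /=.
  rewrite inE; apply/eqP/and3P => [->|[/monicP pm /size_poly1P[c c0 Dp] _]].
    by rewrite monic1 size_poly1 /fixedp rmorph1.
  by rewrite Dp lead_coefC in pm *; rewrite pm.
apply/allpairsP/and3P => [[[g c] [/= gm cF ->]] | [pm /eqP sp pf]].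
  move: gm; rewrite IH => /and3P[gm /eqP sg gf].
  have sc : (size (c%:P : {poly K}) < size (g * 'X)%R)%N.
    by rewrite size_mulX ?(monic_neq0 gm) // sg (leq_ltn_trans (size_polyC_leq1
      c)).
  rewrite monicE lead_coefDl // lead_coefM lead_coefX mulr1 -monicE gm
    size_polyDl //.
  rewrite size_mulX ?(monic_neq0 gm) // sg eqxx; split=> //.
  rewrite mem_Fq // expn1 in cF.
  by rewrite /fixedp rmorphD rmorphM /= map_polyX map_polyC /= (eqP gf) [frob
    hq c](eqP cF).
move: sp pm pf; elim/poly_ind: p => [|g c _]; first by rewrite size_poly0.
have [->|g0] := eqVneq g 0.
  by rewrite mul0r add0r => sc; have := size_polyC_leq1 c; rewrite sc.
have sc : (size (c%:P : {poly K}) < size (g * 'X)%R)%N.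
  by rewrite size_mulX // (leq_ltn_trans (size_polyC_leq1 c)) // ltnS lt0n
    size_poly_eq0.
rewrite size_polyDl // size_mulX // => -[sg].
rewrite monicE lead_coefDl // lead_coefM lead_coefX mulr1 => gm.
rewrite /fixedp rmorphD rmorphM /= map_polyX map_polyC /= => /eqP e.
have ec : frob hq c = c.
  by have := congr1 (fun r : {poly K} => r`_0) e;
    rewrite !coefD !coefMX !coefC /= !add0r.
have eg : map_poly (frob hq) g = g.
  apply: (mulIf (negbT (polyX_eq0 K))); move: e; rewrite ec; exact: addIr.
exists (g, c); rewrite /= IH /fixedp eg eqxx sg monicE gm eqxx.
by rewrite mem_Fq // expn1; split=> //; apply/eqP.
Qed.

Lemma uniq_monics n : uniq (monics n).
Proof.
elim: n => //= n IH; apply: allpairs_uniq => //; first exact: uniq_Fq.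
move=> [g c] [g' c'] _ _ /= e.
have ec : c = c'.
  by have := congr1 (fun r : {poly K} => r`_0) e;
    rewrite !coefD !coefMX !coefC /= !add0r.
by congr (_, _) => //; apply: (mulIf (negbT (polyX_eq0 K))); move: e;
  rewrite ec; exact: addIr.
Qed.
End Fixed.

(** * The L-function of an exponential sum *)

Section Lfunction.
Variables (K : closedFieldType) (q : nat) (hq : [pchar K].-nat q).
Hypothesis q_gt1 : (1 < q)%N.
Variables (C : fieldType) (psi : K -> C).
Hypothesis psiD : forall x y, x ^+ q = x -> y ^+ q = y ->
  psi (x + y) = psi x * psi y.
Hypothesis psi0 : psi 0 = 1.
Variables (f : {poly K}) (d : nat).
Hypothesis f_fixed : fixedp hq f.
Implicit Types (x y : K) (p g h : {poly K}).
Local Notation monics := (monics K q).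
Local Notation Fq := (Fq K q).

(** For the minimal polynomial of [x] this is the trace of [f.[x]]. *)
Definition root_sum p := \sum_(a <- roots_of p) f.[a].
Definition char_of_poly p := psi (root_sum p).

Lemma root_sum_fixed p : p \is monic -> fixedp hq p ->
  root_sum p ^+ q = root_sum p.
Proof.
move=> pm pf; rewrite -[LHS]/(frob hq _) /root_sum rmorph_sum /=.
rewrite -[RHS](perm_big _ (fixedp_perm pm pf)) big_map /=.
by apply: eq_bigr => x _; rewrite -[LHS]/(f.[x] ^+ q) (fixedp_horner _ f_fixed).
Qed.

Lemma root_sum_prod (s : seq K) :
  root_sum (\prod_(z <- s) ('X - z%:P)) = \sum_(z <- s) f.[z].
Proof.
apply: perm_big; apply: prod_XsubC_eq.
by rewrite -roots_ofE ?monic_prod_XsubC.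
Qed.

Lemma root_sumM p g : p \is monic -> g \is monic ->
  root_sum (p * g) = root_sum p + root_sum g.
Proof.
move=> pm gm; rewrite {1}(roots_ofE pm) {1}(roots_ofE gm) -big_cat /=.
by rewrite root_sum_prod big_cat.
Qed.

Lemma char_of_polyM p g : p \is monic -> g \is monic -> fixedp hq p ->
  fixedp hq g ->
  char_of_poly (p * g) = char_of_poly p * char_of_poly g.
Proof. by move=> *; rewrite /char_of_poly root_sumM // psiD // root_sum_fixed.
Qed.

(** The [n]-th coefficient of the L-function of [f] and [psi]. *)
Definition Lcoef n : C := \sum_(g <- monics n) char_of_poly g.

Lemma Lcoef0 : Lcoef 0 = 1.
Proof.
rewrite /Lcoef big_seq1 /char_of_poly -psi0; congr psi.
by have := root_sum_prod [::]; rewrite !big_nil.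
Qed.

Hypothesis size_f : size f = d.+1.
Hypothesis d_gt0 : (0 < d)%N.
Hypothesis dK : d%:R != 0 :> K.

Lemma root_sum_power_sum p : root_sum p =
  \sum_(j < d.+1) f`_j * power_sum (roots_of p) j.
Proof.
rewrite /root_sum /power_sum; under eq_bigr do rewrite horner_coef size_f.
by rewrite exchange_big; apply: eq_bigr => j _; rewrite mulr_sumr.
Qed.

(** [root_sum] depends on the roots through their power sums of index at most
    [d], and these are determined by the [d] coefficients below the leading
    one. *)
Lemma root_sum_shift g c n : (d <= n)%N -> g \in monics n -> c ^+ q = c ->
  [/\ g + c *: 'X^(n - d) \in monics n &
   root_sum (g + c *: 'X^(n - d)) = root_sum g + - (f`_d * c *+ d)].
Proof.
move=> dn; rewrite !(mem_monics hq) // => /and3P[gm /eqP sg gf] hc.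
set g' := g + _.
have sc : (size (c *: 'X^(n - d)) < size g)%N.
  rewrite sg (leq_ltn_trans (size_scale_leq _ _)) // size_polyXn.
  by rewrite ltnS -subSn // leq_subLR addnC -addn1 leq_add2l.
have gm' : g' \is monic by rewrite monicE lead_coefDl.
have sg' : size g' = n.+1 by rewrite size_polyDl.
have sr : size (roots_of g) = n by apply: succn_inj; rewrite -size_roots_of.
have sr' : size (roots_of g') = n by apply: succn_inj; rewrite -size_roots_of.
have ec i : (i <= n)%N -> (recip_poly (roots_of g'))`_i =
    (recip_poly (roots_of g))`_i + (c *+ (i == d)).
  move=> iln; rewrite !coef_recip_poly ?sr ?sr' // -!roots_ofE //.
  rewrite coefD coefZ coefXn; congr (_ + _).
  have -> : (n - i == n - d)%N = (i == d).
    apply/eqP/eqP => [|->//] e.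
    by rewrite -(subKn iln) e subKn.
  by case: (i == d); rewrite ?mulr1 ?mulr0.
split.
  rewrite gm' sg' eqxx /=; rewrite /fixedp rmorphD /= (eqP gf).
  by rewrite map_polyZ map_polyXn /= [frob hq c]hc.
have ec' i : (i < d)%N -> (recip_poly (roots_of g))`_i =
    (recip_poly (roots_of g'))`_i.
  move=> id; rewrite ec ?(leq_trans (ltnW id)) //.
  by rewrite (ltn_eqF id) addr0.
have ecd : (recip_poly (roots_of g'))`_d = (recip_poly (roots_of g))`_d + c.
  by rewrite ec // eqxx.
rewrite !root_sum_power_sum !big_ord_recr /= (power_sum_coef_shift d_gt0 ec'
  ecd).
rewrite mulrBr addrA mulrnAr; congr (_ + _ - _).
apply: eq_bigr => -[[|j] jd] _ /=.
  by rewrite /power_sum; under eq_bigr do rewrite expr0;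
     under [in RHS]eq_bigr do rewrite expr0;
       rewrite !big_const_seq !count_predT sr sr'.
congr (_ * _); case: d d_gt0 jd ec' {ec ecd} => // d' _ jd ec'.
by rewrite (@power_sum_coef_eq _ (roots_of g) (roots_of g') d').
Qed.

Hypothesis psi_nontriv : exists2 c, c ^+ q = c & psi c != 1.

(** Translation by [c X ^ (n - d)] permutes the monic polynomials of degree [n]
    and multiplies every summand by the same value of [psi], which is not [1]
    when [c] is well chosen. *)
Lemma Lcoef_eq0 n : (d <= n)%N -> Lcoef n = 0.
Proof.
move=> dn; have [b hb psib] := psi_nontriv.
have fd0 : f`_d != 0 by rewrite -[d]/(d.+1.-1) -size_f -/(lead_coef f)
  lead_coef_eq0 -size_poly_eq0 size_f.
have fdq : f`_d ^+ q = f`_d.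
  by have := congr1 (fun p : {poly K} => p`_d) (eqP f_fixed); rewrite coef_map.
have dq : d%:R ^+ q = d%:R :> K by rewrite -[LHS]/(frob hq _) rmorph_nat.
(* With this [c] the factor [psi (- (f`_d * c *+ d))] is [psi b]. *)
pose c := - (b / (f`_d * d%:R)).
have hc : c ^+ q = c.
  by rewrite -[LHS]/(frob hq _) rmorphN fmorph_div rmorphM /= [frob hq b]hb
             [frob hq f`_d]fdq [frob hq d%:R]dq.
have hperm : perm_eq [seq g + c *: 'X^(n - d) | g <- monics n] (monics n).
  apply: uniq_perm; rewrite ?map_inj_uniq ?(uniq_monics hq) //.
    exact: addIr.
  move=> g; apply/mapP/idP => [[h hm ->]|gm].
    by have [] := root_sum_shift dn hm hc.
  exists (g + (- c) *: 'X^(n - d)); last by rewrite scaleNr subrK.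
  have hNc : (- c) ^+ q = - c by rewrite -[LHS]/(frob hq _) rmorphN /= [frob hq
    c]hc.
  by have [] := root_sum_shift dn gm hNc.
have : Lcoef n = psi b * Lcoef n.
  rewrite {1}/Lcoef -(perm_big _ hperm) big_map /Lcoef mulr_sumr.
  apply: eq_big_seq => g gm; rewrite /char_of_poly.
  have [_ ->] := root_sum_shift dn gm hc.
  have -> : - (f`_d * c *+ d) = b.
    rewrite /c mulrN mulNrn opprK -[LHS]mulr_natr mulrAC mulrCA mulfV ?mulr1 //.
    by rewrite mulf_neq0.
  move: gm; rewrite (mem_monics hq) // => /and3P[gm _ gf].
  by rewrite addrC psiD // root_sum_fixed.
move/eqP; rewrite -subr_eq0 -{1}[Lcoef n]mul1r -mulrBl mulf_eq0 subr_eq0 eq_sym.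
by rewrite (negPf psib) => /eqP.
Qed.
End Lfunction.

(** * Frobenius orbits of roots *)

Section Orbits.
Variables (K : closedFieldType) (q : nat) (hq : [pchar K].-nat q).
Hypothesis q_gt1 : (1 < q)%N.
Implicit Types (x y : K) (p g h : {poly K}).
Local Notation Fq := (Fq K q).

Lemma exprqD x i j : x ^+ (q ^ (i + j)) = (x ^+ (q ^ i)) ^+ (q ^ j).
Proof. by rewrite -exprM expnD. Qed.

(** When [x] lies in the field with [q ^ k] elements, this is the norm of [X -
    x], that is the minimal polynomial of [x] over the field with [q] elements,
    raised to the power [k / m] where [m] is its degree. *)
Definition orbit_poly k x : {poly K} := \prod_(i < k) ('X - (x ^+ (q ^ i))%:P).

Lemma orbit_polyE k x :
  orbit_poly k x = \prod_(z <- [seq x ^+ (q ^ i) | i : 'I_k]) ('X - z%:P).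
Proof. by rewrite /orbit_poly big_image. Qed.

Lemma orbit_poly_monic k x : orbit_poly k x \is monic.
Proof. by rewrite orbit_polyE monic_prod_XsubC. Qed.

Lemma size_orbit_poly k x : size (orbit_poly k x) = k.+1.
Proof. by rewrite orbit_polyE size_prod_XsubC size_map -cardE card_ord. Qed.

Lemma orbit_poly_fixed k x : (0 < k)%N -> x \in Fq k ->
  fixedp hq (orbit_poly k x).
Proof.
case: k => // k _; rewrite mem_Fq // => /eqP xk.
rewrite /fixedp rmorph_prod /= [X in _ == X]big_ord_recl big_ord_recr /= mulrC.
apply/eqP; congr (_ * _).
  by rewrite rmorphB /= map_polyX map_polyC /= [frob hq _](frobX q x k) xk
    expr1.
apply: eq_bigr => i _; rewrite rmorphB /= map_polyX map_polyC /=.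
by rewrite [frob hq _](frobX q x i).
Qed.

(** The conjugates of [x] are roots of [g], so two of them coincide, and
    Frobenius is injective. *)
Lemma frob_period g x : g != 0 -> fixedp hq g -> root g x ->
  exists2 m, (0 < m)%N & forall k, (x ^+ (q ^ k) == x) = (m %| k)%N.
Proof.
move=> g0 gf gx.
(* One more conjugate than [g] can have roots. *)
pose s := mkseq (fun i => x ^+ (q ^ i)) (size g).
have : ~~ uniq s.
  apply/negP => us; have /(max_poly_roots g0)/(_ us) : all (root g) s.
    apply/allP => y /mapP[i _ ->].
    by rewrite /root -(fixedp_hornerX _ _ gf) (eqP gx) expr0n expn_eq0 eqn0Ngt
      (ltnW q_gt1).
  by rewrite size_mkseq ltnn.
case/(uniqPn 0) => i [j [ij]]; rewrite size_mkseq => js.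
rewrite !nth_mkseq ?(ltn_trans ij) // => e.
have ex : exists m, (0 < m)%N && (x ^+ (q ^ m) == x).
  exists (j - i)%N; rewrite subn_gt0 ij /=; apply/eqP.
  by apply: (exprq_inj hq (i := i)); rewrite /= -exprqD subnK 1?ltnW.
case: (ex_minnP ex) => m /andP[m0 /eqP xm] mmin; exists m => // k.
have xcm c : x ^+ (q ^ (c * m)) = x.
  by elim: c => [|c IH]; rewrite ?mul0n ?expr1 // mulSn exprqD xm IH.
rewrite {1}(divn_eq k m) exprqD xcm /dvdn; apply/eqP/eqP => [e1|->];
  last by rewrite expr1.
apply/eqP; rewrite -leqn0 leqNgt; apply/negP => k0.
by have := mmin _ (introT andP (conj k0 (introT eqP e1)));
  rewrite leqNgt ltn_mod m0.
Qed.

Lemma mup_frob g x i : g \is monic -> fixedp hq g ->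
  mup (x ^+ (q ^ i)) g = mup x g.
Proof.
move=> gm gf; elim: i => [|i IH]; first by rewrite expr1.
rewrite -IH -[X in mup X]frobX {1}(roots_ofE gm) [in RHS](roots_ofE gm)
  !mu_prod_XsubC.
rewrite -(seq.permP (fixedp_perm gm gf)) count_map; apply: eq_count => y /=.
by rewrite -[_ ^+ q]/(frob hq _) (inj_eq (fmorph_inj _)).
Qed.

Lemma orbit_polyM x m j : x ^+ (q ^ m) = x ->
  orbit_poly (j * m) x = orbit_poly m x ^+ j.
Proof.
move=> xm; elim: j => [|j IH];
  first by rewrite mul0n expr0 /orbit_poly big_ord0.
rewrite mulSn exprS -IH /orbit_poly big_split_ord /=; congr (_ * _).
by apply: eq_bigr => i _; rewrite exprqD xm.
Qed.

(** Let [m] be the degree of [x] and [mu] its multiplicity in [g]. Then [x]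
    lies in the field with [q ^ k] elements exactly when [k = j * m], and in
    this case the orbit polynomial is the [j]-th power of a separable
    polynomial all of whose roots have multiplicity [mu] in [g]; so it divides
    [g] exactly when [j <= mu]. *)
Lemma count_orbit_poly g x n : g \is monic -> size g = n.+1 -> fixedp hq g ->
    root g x ->
  (\sum_(k < n) ((x \in Fq k.+1) && (orbit_poly k.+1 x %| g)%R))%N = mup x g.
Proof.
move=> gm sg gf gx; have g0 := monic_neq0 gm.
have [m m0 hm] := frob_period g0 gf gx; set mu := mup x g.
have xm : x ^+ (q ^ m) = x by apply/eqP; rewrite hm dvdnn.
have dvd j : (orbit_poly (j * m) x %| g) = (j <= mu)%N.
  apply/idP/idP => [jg|jmu].
    rewrite /mu mup_geq // (dvdp_trans _ jg) // orbit_polyM // dvdp_exp2r //.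
    by rewrite /orbit_poly -(prednK m0) big_ord_recl /= expr1 dvdp_mulr.
  have op0 := monic_neq0 (orbit_poly_monic (j * m) x).
  rewrite orbit_polyE; apply: prod_XsubC_dvdp_mup => // y;
    rewrite -mu_prod_XsubC -orbit_polyE.
  rewrite orbit_polyM //.
  have -> : mup y (orbit_poly m x ^+ j) = (j * mup y (orbit_poly m x))%N.
    elim: j {jmu op0} => [|j IH];
      first by rewrite expr0 mupNroot // rootC oner_eq0.
    by rewrite exprS mupM ?expf_neq0 ?monic_neq0 ?orbit_poly_monic // IH mulSn.
  have um : uniq [seq x ^+ (q ^ i) | i : 'I_m].
    rewrite map_inj_in_uniq ?enum_uniq // => i1 i2 _ _ e; apply/val_inj.
    wlog i12 : i1 i2 e / (i1 <= i2)%N.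
      by move=> W; case/orP: (leq_total i1 i2) => /W->.
    apply/eqP; rewrite eqn_leq i12 /= -subn_eq0 /=.
    have : x ^+ (q ^ (i2 - i1)) == x.
      by apply/eqP/(exprq_inj hq (i := i1)); rewrite /= -exprqD subnK.
    rewrite hm => /dvdnP[c Dc]; apply/eqP; case: c Dc => [->//|c Dc].
    have := leq_subr i1 i2; rewrite Dc mulSn leqNgt (leq_trans (ltn_ord i2)) //.
    by rewrite leq_addr.
  rewrite orbit_polyE mu_prod_XsubC count_uniq_mem //.
  case: (boolP (y \in _)) => [/mapP[i _ ->]|_]; last by rewrite muln0.
  by rewrite muln1 mup_frob.
have mun : (mu * m <= n)%N.
  rewrite -ltnS -sg -(size_orbit_poly (mu * m) x) dvdp_leq //.
  by rewrite dvd.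
transitivity (count (fun k => (m %| k)%N && (k %/ m <= mu)%N) (iota 1 n)).
  have -> : iota 1 n = index_iota 1 n.+1 by rewrite /index_iota subSS subn0.
  rewrite -sum1_count.
  rewrite [RHS]big_mkcond big_add1 /= big_mkord.
  apply: eq_bigr => k _.
  rewrite mem_Fq // hm; case: (boolP (m %| k.+1)%N) => //= /dvdnP[j ->].
  by rewrite mulnK // dvd; case: leqP.
rewrite -size_filter.
suff /perm_size-> : perm_eq [seq k <- iota 1 n | (m %| k)%N && (k %/ m <= mu)%N]
   [seq (j * m)%N | j <- iota 1 mu] by rewrite size_map size_iota.
apply: uniq_perm; rewrite ?filter_uniq ?iota_uniq //.
  rewrite map_inj_uniq ?iota_uniq // => a b /eqP.
  by rewrite eqn_pmul2r // => /eqP.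
move=> k; rewrite mem_filter mem_iota add1n ltnS; apply/idP/mapP.
  case/andP => /andP[/dvdnP[j ->]]; rewrite mulnK // => jmu /andP[j0 _].
  exists j => //; rewrite mem_iota add1n ltnS jmu andbT.
  by move: j0; rewrite muln_gt0 => /andP[].
case=> j; rewrite mem_iota add1n ltnS => /andP[j0 jmu] ->.
rewrite dvdn_mull // mulnK // jmu /= muln_gt0 j0 m0 /=.
by rewrite (leq_trans _ mun) // leq_mul2r jmu orbT.
Qed.

Lemma sum_orbit_polys g n : g \in monics K q n ->
  (\sum_(k < n) count (fun x => orbit_poly k.+1 x %| g)%R (Fq k.+1))%N = n.
Proof.
rewrite (mem_monics hq) // => /and3P[gm /eqP sg gf].
pose r := roots_of g.
have sr : size r = n by apply: succn_inj; rewrite -size_roots_of.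
have cntE (T : Type) (b : pred T) (s : seq T) : count b s = (\sum_(x <- s) b
  x)%N.
  by rewrite -sum1_count big_mkcond; apply: eq_bigr => x _; case: (b x).
transitivity (\sum_(x <- undup r)
   \sum_(k < n) ((x \in Fq k.+1) && (orbit_poly k.+1 x %| g)%R))%N.
  rewrite exchange_big; apply: eq_bigr => k _ /=; rewrite -cntE -!size_filter.
  apply/perm_size/uniq_perm; rewrite ?filter_uniq ?undup_uniq ?(uniq_Fq hq) //.
  move=> x; rewrite !mem_filter mem_undup andbC -andbA; case: (x \in Fq _) =>
    //=.
  case: (boolP (_ %| g)) => [Ng|]; rewrite ?andbF ?andbT //.
  rewrite -root_prod_XsubC -roots_ofE //; apply/esym; rewrite -dvdp_XsubCl.
  apply: dvdp_trans Ng.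
  by rewrite /orbit_poly big_ord_recl /= expr1 dvdp_mulr.
rewrite (eq_big_seq (fun x => count_mem x r)); last first.
  move=> x; rewrite mem_undup => xr.
  rewrite (@count_orbit_poly g x n) //;
    first by rewrite {1}(roots_ofE gm) mu_prod_XsubC.
  by rewrite (roots_ofE gm) root_prod_XsubC.
rewrite -sr -sum1_size (eq_bigr _ (fun x _ =>
  cntE _ (pred1 x) r)) exchange_big /=.
apply: eq_big_seq => y yr; rewrite -(eq_bigr _ (fun x _ =>
  congr1 nat_of_bool (eq_sym x y))).
rewrite -[LHS](cntE _ (pred1 y)) count_uniq_mem ?undup_uniq //.
by rewrite mem_undup yr.
Qed.
End Orbits.

(** * The logarithmic derivative of the L-function *)

Section Recurrence.
Variables (K : closedFieldType) (q : nat) (hq : [pchar K].-nat q).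
Hypothesis q_gt1 : (1 < q)%N.
Variables (C : fieldType) (psi : K -> C).
Hypothesis psiD : forall x y, x ^+ q = x -> y ^+ q = y ->
  psi (x + y) = psi x * psi y.
Variables (f : {poly K}).
Hypothesis f_fixed : fixedp hq f.

(** The argument of [psi] is the trace of [f.[x]], as [f] commutes with
    Frobenius. *)
Definition char_sum n : C :=
  \sum_(x <- Fq K q n) psi (\sum_(i < n) f.[x ^+ (q ^ i)]).

(** A quotient of polynomials fixed by Frobenius is fixed, so every multiple of
    the orbit polynomial has an admissible cofactor. *)
Lemma perm_orbit_poly_mul n k x : (k < n)%N -> x \in Fq K q k.+1 ->
  perm_eq [seq orbit_poly q k.+1 x * h | h <- monics K q (n - k.+1)]
          [seq g <- monics K q n | orbit_poly q k.+1 x %| g].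
Proof.
move=> kn xF; set N := orbit_poly _ _ _.
have Nm : N \is monic := orbit_poly_monic _ _ _.
have N0 := monic_neq0 Nm; have Nf : fixedp hq N by apply: orbit_poly_fixed.
apply: uniq_perm; rewrite ?filter_uniq ?(map_inj_uniq (mulfI N0)) ?(uniq_monics
  hq) //.
move=> g; rewrite mem_filter (mem_monics hq) //.
apply/mapP/and4P => [[h]|[/dvdpP[h ->]]].
  rewrite (mem_monics hq) // => /and3P[hm /eqP sh hf] ->; split.
  - exact: dvdp_mulr.
  - by rewrite monicMl.
  - by rewrite size_mul ?monic_neq0 // sh size_orbit_poly addSn /= addnS subnKC.
  - exact: fixedpM.
rewrite mulrC monicMl // => hm /eqP; rewrite size_mul ?monic_neq0 //.
rewrite size_orbit_poly addSn /= => sh hf; exists h => //.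
rewrite (mem_monics hq) // hm (fixedp_divr N0 Nf hf) andbT /=.
by apply/eqP; rewrite -subSn // -sh addKn.
Qed.

(** The product [S_k * D_(n - k)] is a sum over pairs of an orbit polynomial
    [N] of degree [k] and a cofactor [h]; by multiplicativity the summand
    depends only on [g = N * h], and each [g] arises from [n] pairs, over all
    [k], by [sum_orbit_polys]. *)
Lemma Lcoef_recurrence n :
  Lcoef q psi f n *+ n =
  \sum_(k < n) char_sum k.+1 * Lcoef q psi f (n - k.+1).
Proof.
transitivity (\sum_(k < n) \sum_(x <- Fq K q k.+1)
    \sum_(g <- monics K q n | orbit_poly q k.+1 x %| g) char_of_poly psi f g);
      last first.
  apply: eq_bigr => k _; rewrite mulr_suml; apply: eq_big_seq => x xF.
  rewrite -big_filter -(perm_big _ (perm_orbit_poly_mul (ltn_ord k) xF))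
    big_map /=.
  rewrite mulr_sumr; apply: eq_big_seq => h.
  rewrite (mem_monics hq) // => /and3P[hm _ hf].
  rewrite (@char_of_polyM _ _ hq _ _ psiD) ?orbit_poly_monic ?orbit_poly_fixed
    //.
  by rewrite /char_of_poly orbit_polyE root_sum_prod big_image.
have dvdE x k : \sum_(g <- monics K q n | orbit_poly q k.+1 x %| g)
  char_of_poly psi f g
   = \sum_(g <- monics K q n) char_of_poly psi f g *+ (orbit_poly q k.+1 x %|
     g)%R.
  by rewrite big_mkcond; apply: eq_bigr => g _; case: ifP.
under [RHS]eq_bigr => k _ do (under eq_bigr do rewrite dvdE;
  rewrite exchange_big).
rewrite /= exchange_big /Lcoef -sumrMnl; apply: eq_big_seq => g gm /=.
under [RHS]eq_bigr do rewrite sumrMnr.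
rewrite sumrMnr -{1}(sum_orbit_polys hq q_gt1 gm); congr (_ *+ _).
apply: eq_bigr => k _.
by rewrite -sum1_count big_mkcond; apply: eq_bigr => x _; case: (_ %| _).
Qed.
End Recurrence.

(** * Inverse roots of the L-function *)

Section InverseRoots.
Variables (K : closedFieldType) (q : nat) (hq : [pchar K].-nat q).
Hypothesis q_gt1 : (1 < q)%N.
Variables (C : closedFieldType) (psi : K -> C).
Hypothesis psiD : forall x y, x ^+ q = x -> y ^+ q = y ->
  psi (x + y) = psi x * psi y.
Hypothesis psi0 : psi 0 = 1.
Hypothesis psi_nontriv : exists2 c, c ^+ q = c & psi c != 1.
Variables (f : {poly K}) (d : nat).
Hypothesis f_fixed : fixedp hq f.
Hypothesis size_f : size f = d.+2.
Hypothesis dK : d.+1%:R != 0 :> K.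
Local Notation Lc := (Lcoef q psi f).

(** The numbers [ws] are the roots of the reversed L-polynomial. Newton's
    identities for them and the recurrence of the L-function determine the two
    sequences recursively from the same coefficients. *)
Lemma char_sum_power_sum :
  exists2 ws : seq C, size ws = d &
    forall n, char_sum q psi f n.+1 = - power_sum ws n.+1.
Proof.
(* [P] is monic because [Lc 0 = 1]; reversing it gives the L-polynomial. *)
pose P := \poly_(i < d.+1) Lc (d - i).
have Pd : P`_d = 1 by rewrite coef_poly ltnSn subnn Lcoef0.
have sP : size P = d.+1 by rewrite size_poly_eq // subnn Lcoef0 // oner_neq0.
have Pm : P \is monic by rewrite monicE /lead_coef sP Pd.
pose ws := roots_of P; exists ws => [|n].
  by apply: succn_inj; rewrite -size_roots_of.
have sws : size ws = d by apply: succn_inj; rewrite -size_roots_of.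
have Lrecip n' : Lc n' = (recip_poly ws)`_n'.
  case: (leqP n' d) => [nd|dn].
    rewrite coef_recip_poly sws // -roots_ofE // coef_poly ltnS leq_subr.
    by rewrite subKn.
  rewrite (Lcoef_eq0 q_gt1 psiD f_fixed size_f) // nth_default //.
  by rewrite (leq_trans (size_recip_poly _)) // sws.
elim/ltn_ind: n => n IH.
have := Lcoef_recurrence q_gt1 psiD f_fixed n.+1.
rewrite Lrecip newton_identity -sumrN !big_ord_recr /= !subnn Lrecip
  coef0_recip_poly !mulr1.
rewrite (eq_bigr (fun i : 'I_n => char_sum q psi f i.+1 * Lc (n.+1 - i.+1))).
  by move/addrI.
by move=> i _; rewrite IH // Lrecip mulNr.
Qed.
End InverseRoots.

Section Growth.
Variable R : realType.

Lemma bernoulli_le (t : R) n : 1 <= t -> 1 + (t - 1) *+ n <= t ^+ n.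
Proof.
move=> t1; elim: n => [|n IH]; first by rewrite mulr0n addr0.
rewrite exprS mulrS addrCA -[t in t * _](subrK 1) mulrDl mul1r lerD //.
by rewrite ler_peMr ?subr_ge0 // exprn_ege1.
Qed.

Lemma expr_unbounded (t M : R) : 1 < t -> exists n, M < t ^+ n.
Proof.
move=> t1; pose n := Num.bound (`|M| / (t - 1)); exists n.
have t0 : 0 < t - 1 by rewrite subr_gt0.
have h : `|M| / (t - 1) < n%:R.
  by apply: archi_boundP; rewrite divr_ge0 // ltW.
rewrite (lt_le_trans _ (bernoulli_le n (ltW t1))) // (le_lt_trans (ler_norm M))
  //.
by rewrite ltr_wpDl // -mulr_natl -ltr_pdivrMr.
Qed.

Lemma expr_le_mul_bound (a b c A : R[i]) k0 : 0 <= a -> 0 < b -> 0 < A ->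
  (forall k, (k0 <= k)%N -> A * a ^+ k <= c * b ^+ k) -> a <= b.
Proof.
move=> a0 b0 A0 h; rewrite real_leNgt ?ger0_real ?(ltW b0) //; apply/negP => ba.
pose t := a / b.
have t1 : 1 < t by rewrite /t ltr_pdivlMr // mul1r.
have ht k : (k0 <= k)%N -> t ^+ k <= c / A.
  move=> /h; rewrite expr_div_n ler_pdivlMr // mulrAC ler_pdivrMr ?exprn_gt0 //.
  by rewrite mulrC.
have tR : t = real_complex R (complex.Re t).
  by rewrite RRe_real // ger0_real // divr_ge0 // ltW.
have rt1 : 1 < complex.Re t by move: t1;
  rewrite tR -[1]/(real_complex R 1) ltcR.
have [n hn] := expr_unbounded (complex.Re (c / A)) rt1.
have := ht (maxn n k0) (leq_maxr _ _).
rewrite tR -rmorphXn /= lecE /= => /andP[_]; rewrite leNgt => /negP; apply.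
rewrite (lt_le_trans hn) // ler_weXn2l ?leq_maxl //; exact: ltW.
Qed.

(** Let the polynomial [G] vanish at every other member of [ws]. Combining the
    power sums of index [k + j] with the coefficients of [G] isolates [w ^ k *
    G.[w]], times the multiplicity of [w]; so [w ^ k] itself grows no faster
    than [b ^ k]. *)
Lemma power_sum_growth (ws : seq R[i]) (b c : R[i]) k0 : 0 < b -> 0 <= c ->
    (forall k, (k0 <= k)%N -> `|power_sum ws k| <= c * b ^+ k) ->
  forall w, w \in ws -> `|w| <= b.
Proof.
move=> b0 c0 h w wws.
pose G := \prod_(z <- ws | z != w) ('X - z%:P).
have Gw : G.[w] != 0.
  rewrite horner_prod prodf_seq_neq0; apply/allP => z _; apply/implyP => zw.
  by rewrite hornerXsubC subr_eq0 eq_sym.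
have Gz z : z \in ws -> z != w -> G.[z] = 0.
  move=> zws zw; apply/eqP; rewrite horner_prod prodf_seq_eq0; apply/hasP.
  by exists z => //; rewrite zw hornerXsubC subrr eqxx.
have e k : w ^+ k * G.[w] *+ count_mem w ws =
   \sum_(j < size G) G`_j * power_sum ws (k + j).
  transitivity (\sum_(z <- ws) z ^+ k * G.[z]).
    rewrite (eq_big_seq (fun z => if z == w then w ^+ k * G.[w] else 0));
      last first.
      by move=> z zws; case: eqVneq => [->//|zw]; rewrite Gz ?mulr0.
    by rewrite -big_mkcond big_const_seq iter_addr_0.
  under eq_bigr do rewrite horner_coef mulr_sumr.
  rewrite exchange_big; apply: eq_bigr => j _; rewrite mulr_sumr.
  by apply: eq_bigr => z _; rewrite exprD mulrCA.
pose c' := \sum_(j < size G) `|G`_j| * (c * b ^+ j).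
apply: (@expr_le_mul_bound _ _ c' (`|G.[w]| *+ count_mem w ws) k0) => //.
  rewrite pmulrn_lgt0 ?normr_gt0 //.
  by rewrite -has_count has_pred1.
move=> k kk0; rewrite mulrnAl -normrX -normrM [_ * w ^+ k]mulrC -normrMn e.
rewrite (le_trans (ler_norm_sum _ _ _)) // mulr_suml ler_sum // => j _.
rewrite normrM -!mulrA ler_wpM2l // -exprD [(j + k)%N]addnC h // (leq_trans
  kk0) //.
by rewrite leq_addr.
Qed.
End Growth.

(** * Linear systems, multiple zeros and Taylor expansions *)

Lemma linear_system_kernel (K : fieldType) (I J : finType) (L : I -> J -> K) :
  (#|J| < #|I|)%N ->
  exists2 c : I -> K, exists i, c i != 0 & forall j, \sum_i c i * L i j = 0.
Proof.
move=> ltJI.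
pose A := \matrix_(a < #|I|, b < #|J|) L (enum_val a) (enum_val b).
have : kermx A != 0.
  rewrite kermx_eq0 /row_free neq_ltn (leq_ltn_trans (rank_leq_col A) ltJI) //.
case/rowV0Pn => v /sub_kermxP vA v0.
exists (fun i => v 0 (enum_rank i)) => [|j].
  have [a va] : exists a, v 0 a != 0.
    apply/existsP; apply: contraNT v0 => /existsPn h; apply/eqP/rowP => a.
    by rewrite mxE; apply/eqP; rewrite -[_ == _]negbK h.
  by exists (enum_val a); rewrite enum_valK.
have := congr1 (fun B : 'rV_#|J| => B 0 (enum_rank j)) vA; rewrite !mxE => e;
  apply: etrans e.
rewrite (reindex (@enum_val I I)) /=; last first.
  by apply: onW_bij; exact: enum_val_bij.
by apply: eq_bigr => a _; rewrite enum_valK mxE enum_rankK.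
Qed.

Lemma size_root_multiplicity (K : fieldType) (h : {poly K}) (s : seq K) m :
  h != 0 -> uniq s -> (forall x, x \in s -> ('X - x%:P) ^+ m %| h) ->
  (m * size s < size h)%N.
Proof.
move=> h0 us hs.
have : \prod_(x <- s) ('X - x%:P) ^+ m %| h.
  elim: s us hs => [|x s IH] /= => [_ _|/andP[xs us] hs];
    first by rewrite big_nil dvd1p.
  rewrite big_cons Gauss_dvdp ?hs ?mem_head //=.
    by apply: IH => // y ys; rewrite hs // inE ys orbT.
  rewrite coprimep_expl // coprimep_sym coprimep_XsubC /root horner_prod.
  rewrite prodf_seq_neq0; apply/allP => y ys /=.
  rewrite horner_exp hornerXsubC expf_neq0 // subr_eq0.
  by apply: contraNneq xs => ->.
move/(dvdp_leq h0); apply: leq_trans.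
elim: s {us hs} => [|x s IH]; first by rewrite big_nil size_poly1 muln0.
rewrite big_cons size_monicM ?monic_exp ?monicXsubC //.
  by rewrite size_exp_XsubC addSn /= mulnS -addnS leq_add2l.
by apply/monic_neq0/monic_prod => y _; rewrite monic_exp ?monicXsubC.
Qed.

(** The term of largest size cannot be cancelled. *)
Lemma sum_distinct_sizes_neq0 (R : nzRingType) (I : finType)
    (P : I -> {poly R}) i0 :
    P i0 != 0 ->
    (forall i j, P i != 0 -> P j != 0 -> size (P i) = size (P j) -> i = j) ->
  \sum_i P i != 0.
Proof.
move=> Pi0 inj.
pose i1 := [arg max_(i > i0) size (P i)].
have /= [] : P i1 != 0 /\ forall j, (size (P j) <= size (P i1))%N.
  rewrite /i1; case: arg_maxnP => // i _ hi; split=> [|j]; last exact: hi.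
  by rewrite -size_poly_gt0 (leq_trans _ (hi i0 _)) // size_poly_gt0.
move: {Pi0} i1 => i1 Pi1 hmax.
apply: contraNneq Pi1 => /(congr1 (fun p : {poly R} => p`_(size (P i1)).-1)).
rewrite coef0 (bigD1 i1) //= coefD coef_sum big1 ?addr0 => [e|j ji1].
  by rewrite -lead_coef_eq0 /lead_coef e.
have [->|Pj] := eqVneq (P j) 0; first by rewrite coef0.
have [Pi|Pi] := eqVneq (P i1) 0.
  by have := hmax j; rewrite Pi size_poly0 leqn0 size_poly_eq0 (negPf Pj).
apply: nth_default; rewrite -ltnS prednK ?size_poly_gt0 //.
rewrite ltn_neqAle hmax andbT; apply: contraNneq ji1 => /(inj _ _ Pj Pi) ->.
by [].
Qed.

Section Weight.
Variables (K : fieldType) (e : nat).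
Implicit Types B : {poly {poly K}}.

(** In [B] the outer variable is the increment [eps] of a Taylor expansion.
    Only the coefficients of low powers of [eps] will have to vanish, so it
    matters that their degree in the inner variable grows slowly: this is what
    keeps the number of linear conditions small. *)
Definition slope_le (A : nat) B := forall l,
  (size (B`_l)%R <= (A + e * l).+1)%N.

Lemma slope_leM A A' B B' : slope_le A B -> slope_le A' B' ->
  slope_le (A + A') (B * B').
Proof.
move=> h h' l; rewrite coefM (leq_trans (size_sum _ _ _)) //.
apply/bigmax_leqP => i _; rewrite (leq_trans (size_polyMleq _ _)) //.
have := h i; have := h' (l - i)%N; have : (i <= l)%N by rewrite -ltnS.
nia.
Qed.

Lemma slope_le1 : slope_le 0 1.
Proof. by move=> l; rewrite coef1; case: (l == 0%N);
  rewrite ?size_poly1 ?size_poly0. Qed.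

Lemma slope_leX A B k : slope_le A B -> slope_le (k * A) (B ^+ k).
Proof.
move=> h; elim: k => [|k IH]; first exact: slope_le1.
by rewrite exprS mulSn; exact: slope_leM.
Qed.

Lemma slope_le_sum A (I : finType) (B : I -> {poly {poly K}}) :
  (forall i, slope_le A (B i)) -> slope_le A (\sum_i B i).
Proof.
move=> h l; rewrite coef_sum (leq_trans (size_sum _ _ _)) //.
by apply/bigmax_leqP => i _; exact: h.
Qed.

Lemma slope_leC (p : {poly K}) : slope_le (size p).-1 p%:P.
Proof. by move=> l; rewrite coefC; case: (l == 0%N); rewrite ?size_poly0;
  lia. Qed.
End Weight.

Section Taylor.
Variable K : fieldType.
Implicit Types f p : {poly K}.

(** The Taylor expansion [f (X + eps)], as a polynomial in [eps]. *)
Definition shift_poly f : {poly {poly K}} := f^:P \Po ('X + 'Y).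

Lemma coef0_shift f : (shift_poly f)`_0 = f.
Proof.
rewrite -horner_coef0 /shift_poly horner_comp !hornerE.
by rewrite -[X in X = _]/(f \Po 'X) comp_polyXr.
Qed.

Lemma size_coef_XDY n l : (0 < l)%N ->
  (size ((('X + 'Y) ^+ n : {poly {poly K}})`_l)%R <= n)%N.
Proof.
move=> l0; rewrite addrC exprDn coef_sum (leq_trans (size_sum _ _ _)) //.
apply/bigmax_leqP => i _; rewrite coefMn -polyC_exp coefCM coefXn.
case: eqP => [li|_]; last by rewrite mulr0 mul0rn size_poly0.
rewrite mulr1 -scaler_nat (leq_trans (size_scale_leq _ _)) //.
rewrite size_polyXn; have := ltn_ord i; move: l0; rewrite li; lia.
Qed.

Lemma size_coef_shift f l : (0 < l)%N ->
  (size ((shift_poly f)`_l)%R <= (size f).-1)%N.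
Proof.
move=> l0; rewrite /shift_poly comp_polyE coef_sum (leq_trans (size_sum _ _ _))
  //.
apply/bigmax_leqP => i _; rewrite coefZ coef_map mul_polyC.
rewrite (leq_trans (size_scale_leq _ _)) // (leq_trans (size_coef_XDY _ l0)) //.
by have : (i < size f)%N; [rewrite -(size_map_polyC f) ltn_ord | lia].
Qed.
End Taylor.

(** * Stepanov's auxiliary polynomial *)

Section Stepanov.
Variables (K : fieldType) (q : nat).
Hypothesis q_gt1 : (1 < q)%N.
Variables (f : {poly K}) (d : nat).
Hypothesis size_f : size f = d.+1.
Hypothesis d_gt0 : (0 < d)%N.
Variable a : K.

(** Its value on the field with [q ^ n] elements is [Tr (f.[x]) - a]. *)
Definition trace_poly n : {poly K} := \sum_(s < n) f ^+ (q ^ s) - a%:P.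

Lemma size_fXq s : size (f ^+ (q ^ s)) = (d * q ^ s).+1.
Proof.
have f0 : f != 0 by rewrite -size_poly_eq0 size_f.
by rewrite -[LHS]prednK ?size_poly_gt0 ?expf_neq0 // size_exp size_f.
Qed.

Lemma size_trace_poly n : size (trace_poly n.+1) = (d * q ^ n).+1.
Proof.
have D m : trace_poly m.+1 = f ^+ (q ^ m) + trace_poly m.
  by rewrite /trace_poly big_ord_recr /= addrAC addrC.
have le m : (size (trace_poly m) <= d * q ^ m)%N.
  elim: m => [|m IH].
    rewrite /trace_poly big_ord0 sub0r size_polyN (leq_trans (size_polyC_leq1
      a)) //.
    by rewrite muln1.
  rewrite D (leq_trans (size_polyD _ _)) // geq_max size_fXq (leq_trans IH).
    by rewrite andbT expnS; nia.
  by rewrite expnS; nia.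
by rewrite D size_polyDl size_fXq // ltnS le.
Qed.

(** At a zero [x] of [trace_poly n] in the field with [q ^ n] elements, this is
    the Taylor expansion of [trace_poly n] in [eps] ([at_point_tau]). The
    degrees of its coefficients grow slowly with the power of [eps], although
    the degree of [trace_poly n] is [d * q ^ n.-1]. *)
Definition tau n : {poly {poly K}} :=
  \sum_(s < n) (shift_poly f - f%:P) ^+ (q ^ s).

Lemma slope_tau n : slope_le d.-1 0 (tau n).
Proof.
apply: slope_le_sum => s; rewrite -(muln0 (q ^ s)%N); apply: slope_leX => -[|l].
  by rewrite coefB coefC coef0_shift subrr size_poly0.
rewrite coefB coefC subr0 (leq_trans (size_coef_shift f _)) // size_f.
nia.
Qed.

Variables (n k : nat).
Let D := (q ^ n)%N.
Let M := (q ^ k.+1)%N.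
Let J := (q ^ k + d)%N.
Let Q := (q ^ n.+1)%N.

Local Notation idx := ('I_q * 'I_J * 'I_D)%type.
Variable c : idx -> K.

(** Modulo [eps ^ Q], the factor [(x + eps) ^ Q] is the constant [x] at a point
    of the field with [Q] elements, and there the trace is also replaced by an
    expansion of small slope. Hence an expression of large degree has a Taylor
    expansion, [aux_taylor], of small degree in [x]. *)
Definition aux_poly : {poly K} :=
  \sum_(ije : idx)
    c ije *: ('X^(ije.2) * trace_poly n.+1 ^+ ije.1.1 * 'X^(Q * ije.1.2)).

Definition aux_taylor_term (ije : idx) : {poly {poly K}} :=
  ('X + 'Y) ^+ ije.2 * tau n.+1 ^+ ije.1.1 * 'Y ^+ ije.1.2.

Definition aux_taylor : {poly {poly K}} :=
  \sum_(ije : idx) (c ije)%:P%:P * aux_taylor_term ije.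

Let D_gt0 : (0 < D)%N. Proof. by rewrite expn_gt0 ltnW. Qed.

(** The term with indices [i] and [j] has degree between [(d * i + q * j) * D]
    and [(d * i + q * j + 1) * D - 1], and [d * i + q * j] determines [i] and
    [j] because [i < q] and [d] is prime to [q]. *)
Lemma aux_poly_neq0 : coprime d q ->
  (exists ije, c ije != 0) -> aux_poly != 0.
Proof.
move=> dq; case=> -[[i0 j0] e0] c0.
pose kk (ij : 'I_q * 'I_J) : {poly K} := \sum_(e < D) c (ij, e) *: 'X^e.
pose P ij := kk ij * trace_poly n.+1 ^+ ij.1 * 'X^(Q * ij.2).
have -> : aux_poly = \sum_ij P ij.
  rewrite /aux_poly; pose F ij (e : 'I_D) :=
    c (ij, e) *: ('X^e * trace_poly n.+1 ^+ ij.1 * 'X^(Q * ij.2)).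
  transitivity (\sum_ij \sum_e F ij e).
    by rewrite pair_bigA; apply: eq_bigr => -[ij e].
  apply: eq_bigr => ij _; rewrite /P /kk !mulr_suml; apply: eq_bigr => e _.
  by rewrite /F -!scalerAl.
have D0 := D_gt0.
have kk0 : kk (i0, j0) != 0.
  apply: contraNneq c0 => /(congr1 (fun p : {poly K} => p`_e0)).
  rewrite coef0 coef_sum (bigD1 e0) //= coefZ coefXn eqxx mulr1 big1 ?addr0 =>
    [->//|e ne].
  by rewrite coefZ coefXn eq_sym -[_ == _]/(e == e0) (negPf ne) mulr0.
have T0 : trace_poly n.+1 != 0 by rewrite -size_poly_eq0 size_trace_poly.
have szP ij : P ij != 0 -> ((size (P ij)).-1 %/ D = d * ij.1 + q * ij.2)%N.
  move=> Pij; have kij : kk ij != 0.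
    by apply: contraNneq Pij => e; rewrite /P e !mul0r.
  have skk : (size (kk ij) <= D)%N.
    rewrite (leq_trans (size_sum _ _ _)) //; apply/bigmax_leqP => e _.
    by rewrite (leq_trans (size_scale_leq _ _)) // size_polyXn.
  have Te : trace_poly n.+1 ^+ ij.1 != 0 by rewrite expf_neq0.
  rewrite /P size_mulXn ?mulf_neq0 // size_mul //.
  have -> : size (trace_poly n.+1 ^+ ij.1) = (D * d * ij.1).+1.
    rewrite -[LHS]prednK ?size_poly_gt0 // size_exp size_trace_poly /= -/D; lia.
  have : (0 < size (kk ij))%N by rewrite size_poly_gt0.
  case: (size _) skk => // s skk _.
  have -> : (Q * ij.2 + (s.+1 + (D * d * ij.1).+1).-1).-1 =
     ((d * ij.1 + q * ij.2) * D + s)%N by rewrite /Q expnS -/D; lia.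
  by rewrite divnMDl // divn_small // addn0.
apply: (@sum_distinct_sizes_neq0 _ _ P (i0, j0)).
  by rewrite /P !mulf_neq0 ?expf_neq0 ?polyX_eq0.
move=> [i j] [i' j'] /szP /= h /szP /= h' e.
have {h h' e} e : (d * i + q * j = d * i' + q * j')%N by rewrite -h -h' e.
have ii : i = i' :> nat.
  wlog le_ii' : i i' j j' e / (i <= i')%N => [W|].
    by case/orP: (leq_total i i') => l;
      [apply: (W _ _ j j') | apply/esym/(W _ _ j' j)].
  have : (q %| d * (i' - i))%N by apply/dvdnP; exists (j - j')%N; nia.
  rewrite Gauss_dvdr 1?coprime_sym // => /dvdnP[[|r]]; first by lia.
  by have := ltn_ord i'; nia.
by congr (_, _); apply: val_inj => //=; move: e; rewrite ii; nia.
Qed.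

Lemma slope_aux_term ije : slope_le d.-1 (D + J) (aux_taylor_term ije).
Proof.
have sXY : slope_le d.-1 1 ('X + 'Y : {poly {poly K}}).
  move=> l; rewrite coefD coefX coefC.
  by case: l => [|[|l]] /=; rewrite ?add0r ?addr0 ?size_polyX ?size_poly1
    ?size_poly0.
have sY : slope_le d.-1 1 ('Y : {poly {poly K}}).
  by have := @slope_leC K d.-1 ('X : {poly K}); rewrite size_polyX.
have := slope_leM (slope_leM (slope_leX ije.2 sXY) (slope_leX ije.1.1
  (slope_tau n.+1)))
  (slope_leX ije.1.2 sY).
move=> h l; apply: leq_trans (h l) _.
have := ltn_ord ije.2; have := ltn_ord ije.1.2; lia.
Qed.

Lemma size_aux_poly : (size aux_poly <= (M + 2 * d * q) * D)%N.
Proof.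
rewrite (leq_trans (size_sum _ _ _)) //; apply/bigmax_leqP => -[[i j] e] _ /=.
rewrite (leq_trans (size_scale_leq _ _)) //.
have T0 : trace_poly n.+1 != 0 by rewrite -size_poly_eq0 size_trace_poly.
rewrite size_mulXn ?mulf_neq0 ?expf_neq0 ?polyX_eq0 // size_mul ?expf_neq0
  ?polyX_eq0 //.
rewrite size_polyXn -[size (trace_poly _ ^+ _)]prednK ?size_poly_gt0 ?expf_neq0
  //.
rewrite size_exp size_trace_poly /= -/D /Q expnS -/D /M expnS.
have := ltn_ord e; have := ltn_ord j; have := ltn_ord i; rewrite /J.
set B := (q ^ k)%N; move=> iq jB eD.
have h1 : (q * j + q <= q * (B + d))%N by rewrite addnC -mulnS leq_mul2l jB
  orbT.
have h2 : (d * i + d <= d * q)%N by rewrite addnC -mulnS leq_mul2l iq orbT.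
have : (d * i + q * j + 1 <= q * B + 2 * d * q)%N by nia.
move=> h; have : ((d * i + q * j + 1) * D <= (q * B + 2 * d * q) * D)%N.
  by rewrite leq_mul2r h orbT.
move=> h3; apply: leq_trans h3 => {h}.
have aux u v w E : (w < E ->
  q * E * v + (w + (d * E * u).+1) <= (d * u + q * v + 1) * E)%N.
  by clear; nia.
exact: aux.
Qed.
Hypothesis hq : [pchar K].-nat q.
Hypothesis MD : (2 * k.+1 <= n)%N.

Definition at_point (x : K) : {poly {poly K}} -> {poly K} :=
  map_poly (horner_eval x).

Lemma at_point_shift x p : at_point x (shift_poly p) = p \Po ('X + x%:P).
Proof.
rewrite /at_point /shift_poly map_comp_poly rmorphD /= map_polyX map_polyC /=.
rewrite [horner_eval _ _]hornerX -map_poly_comp; congr (_ \Po _).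
by rewrite map_poly_id // => u _; rewrite /= /horner_eval hornerC.
Qed.

Lemma at_point_tau m x : \sum_(s < m) f.[x] ^+ (q ^ s) = a ->
  at_point x (tau m) = trace_poly m \Po ('X + x%:P).
Proof.
move=> e; rewrite /at_point /tau /trace_poly comp_polyB comp_polyC -e.
rewrite !rmorph_sum /= -sumrB; apply: eq_bigr => s _.
have hqs : [pchar {poly K}].-nat (q ^ s)%N.
  by rewrite pnatX (eq_pnat _ (pchar_poly K)) hq.
rewrite rmorphXn rmorphB /= -/(at_point x) at_point_shift /at_point map_polyC
  /=.
rewrite (exprDn_pchar _ _ hqs) (exprNn_pchar _ hqs) (rmorphXn (comp_poly _)).
by rewrite polyC_exp.
Qed.

Let V := (D + J + d.-1 * M).+1.

Hypothesis c_solves : forall lt : 'I_M * 'I_V,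
  \sum_ije c ije * (aux_taylor_term ije)`_lt.1`_lt.2 = 0.

Lemma coef_aux_taylor l : (l < M)%N -> aux_taylor`_l = 0.
Proof.
move=> lM; rewrite /aux_taylor coef_sum;
  under eq_bigr do rewrite coefCM mul_polyC.
apply/polyP => t; rewrite coef0 coef_sum.
case: (ltnP t V) => [tV|Vt].
  rewrite -[RHS](c_solves (Ordinal lM, Ordinal tV)) /=.
  by apply: eq_bigr => ije _; rewrite coefZ.
apply: big1 => ije _; rewrite coefZ nth_default ?mulr0 //.
apply: leq_trans Vt; apply: leq_trans (slope_aux_term ije l) _.
by rewrite /V ltnS leq_add2l leq_mul2l (ltnW lM) orbT.
Qed.

Let MQ : (M <= Q)%N.
Proof. by rewrite leq_exp2l //; lia. Qed.

(** Up to a multiple of [X ^ Q], hence of [X ^ M], the translate of the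
    auxiliary polynomial by [x] is [aux_taylor] evaluated at [x], whose first
    [M] coefficients were made to vanish identically. *)
Lemma dvdp_aux_poly x : x ^+ Q = x -> \sum_(s < n.+1) f.[x] ^+ (q ^ s) = a ->
  ('X - x%:P) ^+ M %| aux_poly.
Proof.
move=> xQ xa.
suff : 'X^M %| aux_poly \Po ('X + x%:P).
  move/(dvdp_comp_poly ('X - x%:P)).
  by rewrite comp_polyXaddC_K rmorphXn /= comp_polyX.
have -> : aux_poly \Po ('X + x%:P) = at_point x aux_taylor +
   (aux_poly \Po ('X + x%:P) - at_point x aux_taylor) by rewrite [RHS]addrC
     subrK.
apply: dvdp_add.
  rewrite -[X in _ %| X](poly_take_drop M) [take_poly _ _](_ : _ = 0).
    by rewrite add0r dvdp_mull.
  apply/polyP => l; rewrite coef_take_poly coef0; case: ltnP => // lM.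
  by rewrite /at_point coef_map coef_aux_taylor // raddf0.
rewrite /aux_poly /aux_taylor /at_point !rmorph_sum /= -sumrB.
apply: (big_ind (fun p => 'X^M %| p)) => [||[[i j] e] _ /=].
- exact: dvdp0.
- by move=> *; apply: dvdp_add.
rewrite comp_polyZ -mul_polyC /aux_taylor_term /=.
have evM p r : map_poly (horner_eval x) (p * r) =
    map_poly (horner_eval x) p * map_poly (horner_eval x) r by rewrite rmorphM.
have evX p m : map_poly (horner_eval x) (p ^+ m) = map_poly (horner_eval x) p
  ^+ m.
  by rewrite rmorphXn.
rewrite !evM !evX rmorphD /= map_polyX !map_polyC /= [horner_eval x 'X]hornerX.
rewrite [horner_eval x _]hornerC -/(at_point x _) (at_point_tau xa) -mulrBr
  dvdp_mull //.
rewrite !comp_polyM !(rmorphXn (comp_poly _)) /= comp_polyX exprM -mulrBr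
  dvdp_mull //.
have hQ : [pchar {poly K}].-nat Q by rewrite pnatX (eq_pnat _ (pchar_poly K))
  hq.
rewrite (exprDn_pchar _ _ hQ) -[x%:P ^+ Q]polyC_exp xQ subrXX dvdp_mulr //
  addrK.
by rewrite dvdp_exp2l // MQ.
Qed.

End Stepanov.

(** Fewer equations than unknowns: the two sides are [M * D] plus error terms,
    where [M = q * B], and the summand [d] of [B + d] pays for these. *)
Lemma stepanov_dimension d q B D : (0 < d)%N -> (1 < q)%N -> (0 < B)%N ->
  (q * B * (q * B) <= D)%N ->
  (q * B * (D + (B + d) + d.-1 * (q * B)).+1 < q * (B + d) * D)%N.
Proof.
case: d => // d _ q1 B0 MD /=; set M := (q * B)%N in MD *.
have M2 : (2 * B <= M)%N by rewrite leq_mul2r q1 orbT.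
have h1 : (2 * (M * B) <= M * M)%N by rewrite mulnCA leq_mul2l M2 orbT.
have h2 : (2 * M <= M * M)%N by rewrite leq_mul2r; apply/orP; right; lia.
have h3 : (d * (M * M) <= d * D)%N by rewrite leq_mul2l MD orbT.
have h4 : (d * (2 * M) <= d * (M * M))%N by rewrite leq_mul2l h2 orbT.
have D0 : (0 < D)%N by lia.
have h5 : (2 * (d.+1 * D) <= q * (d.+1 * D))%N by rewrite leq_mul2r q1 orbT.
have -> : (q * (B + d.+1) * D = M * D + q * (d.+1 * D))%N by rewrite /M; lia.
move: h1 h2 h3 h4 h5; clearbody M; move: (q * _)%N => X; lia.
Qed.

(** The main term is [q ^ n], the average number of points of a fibre of the
    trace; the choice of [q ^ k.+1] close to [sqrt (q ^ n)] makes the error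
    term of that order as well. *)
Lemma stepanov_bound (K : fieldType) (q : nat) (hq : [pchar K].-nat q)
    (q_gt1 : (1 < q)%N) (f : {poly K}) (d : nat) (size_f : size f = d.+1)
    (d_gt0 : (0 < d)%N) (dq : coprime d q) (a : K) (n k : nat) (s : seq K) :
    (2 * k.+1 <= n)%N -> uniq s ->
    (forall x, x \in s ->
      x ^+ (q ^ n.+1) = x /\ \sum_(i < n.+1) f.[x] ^+ (q ^ i) = a) ->
  (q ^ k.+1 * size s <= (q ^ k.+1 + 2 * d * q) * q ^ n)%N.
Proof.
move=> kn us hs.
pose L (ije : 'I_q * 'I_(q ^ k + d) * 'I_(q ^ n)) 
  (lt : 'I_(q ^ k.+1) * 'I_(q ^ n + (q ^ k + d) + d.-1 * q ^ k.+1).+1) : K :=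
  (aux_taylor_term f ije)`_lt.1`_lt.2.
have [|c c0 hc] := @linear_system_kernel K _ _ L.
  rewrite !card_prod !card_ord expnS stepanov_dimension ?expn_gt0 ?(ltnW q_gt1)
    //.
  by rewrite -expnS -expnD leq_exp2l //; lia.
have h0 := aux_poly_neq0 q_gt1 size_f d_gt0 a dq c0.
have := size_root_multiplicity h0 us _.
move=> /(_ (q ^ k.+1)%N) h.
apply: leq_trans (ltnW (h _)) (size_aux_poly q_gt1 size_f d_gt0 a c) =>
  x /hs[xQ xa].
exact: (dvdp_aux_poly q_gt1 size_f d_gt0 hq kn hc xQ xa).
Qed.

(** * The Weil bound *)

Lemma finField_card_pchar_nat (F : finFieldType) : [pchar F].-nat #|F|.
Proof.
have [p pr_p pF] := finPcharP F.
by rewrite (eq_pnat _ (pcharf_eq pF)) (card_pprimeChar pF) pnatX pnat_id.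
Qed.

Lemma sum_nontrivial_morphism (F : finZmodType) (C : idomainType) (psi : F ->
  C) :
  {morph psi : x y / x + y >-> x * y} -> (exists x, psi x != 1) ->
  \sum_x psi x = 0.
Proof.
move=> psiD [b hb]; apply/eqP; have : \sum_x psi x = psi b * \sum_x psi x.
  rewrite mulr_sumr (reindex (+%R b)) /=; last first.
    by exists (+%R (- b)) => x _; rewrite ?addKr ?addNKr.
  by apply: eq_bigr => x _; rewrite psiD.
move/eqP; rewrite -subr_eq0 -{1}[\sum_x _]mul1r -mulrBl mulf_eq0 subr_eq0.
by rewrite eq_sym (negPf hb).
Qed.

Section Extend.
Variables (F : finFieldType) (K : closedFieldType) (iota : {rmorphism F -> K}).
Local Notation q := #|F|.

Lemma pchar_nat_ext : [pchar K].-nat q.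
Proof.
rewrite (eq_pnat _ (fmorph_pchar iota)); exact: finField_card_pchar_nat.
Qed.
Local Notation hq := pchar_nat_ext.

Let q_gt1 : (1 < q)%N := finRing_gt1 F.

Lemma expq_iota x : iota x ^+ q = iota x.
Proof. by rewrite -rmorphXn expf_card. Qed.

Lemma fixed_iota y : y ^+ q = y -> exists x, y = iota x.
Proof.
move=> hy; have := congr1 (map_poly iota) (finField_genPoly F).
rewrite rmorphB /= map_polyXn map_polyX rmorph_prod => /(congr1 (horner^~ y)).
rewrite !hornerE hy subrr horner_prod => /esym/eqP/prodf_eq0[x _].
rewrite rmorphB /= map_polyX map_polyC /= hornerXsubC subr_eq0 => /eqP->.
by exists x.
Qed.

Lemma fixedp_map f : fixedp hq (map_poly iota f).
Proof.
by apply/eqP/polyP => i; rewrite !coef_map /= [frob _ _]expq_iota.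
Qed.

Lemma perm_Fq1 : perm_eq (Fq K q 1) [seq iota x | x : F].
Proof.
apply: uniq_perm; rewrite ?(uniq_Fq hq) ?(map_inj_uniq (fmorph_inj _))
  ?enum_uniq //.
move=> y; rewrite mem_Fq // expn1; apply/eqP/fintype.imageP =>
  [/fixed_iota[x ->]|[x _ ->]].
  by exists x.
exact: expq_iota.
Qed.

Variables (C : fieldType) (psi : F -> C).
(** The value [1] off the image of [iota] is a placeholder. *)
Definition ext_char (y : K) : C :=
  if [pick x | iota x == y] is Some x then psi x else 1.

Lemma ext_charE x : ext_char (iota x) = psi x.
Proof.
rewrite /ext_char; case: pickP => [z /eqP/fmorph_inj->//|/(_ x)].
by rewrite eqxx.
Qed.

Lemma ext_charD : {morph psi : x y / x + y >-> x * y} ->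
  forall x y, x ^+ q = x -> y ^+ q = y ->
    ext_char (x + y) = ext_char x * ext_char y.
Proof.
move=> psiD _ _ /fixed_iota[x ->] /fixed_iota[y ->].
by rewrite -rmorphD !ext_charE psiD.
Qed.

End Extend.

Section Weil.
Variables (R : realType) (F : finFieldType).
Variable psi : F -> R[i].
Hypothesis psiD : {morph psi : x y / x + y >-> x * y}.
Hypothesis psi_norm : forall x, `|psi x| = 1.
Hypothesis psi_nontriv : exists x, psi x != 1.
Local Notation q := #|F|.
Let q_gt1 : (1 < q)%N := finRing_gt1 F.
Variables (f : {poly F}) (d : nat).
Hypothesis size_f : size f = d.+2.
Hypothesis dF : d.+1%:R != 0 :> F.

Lemma character_at0 : psi 0 = 1.
Proof.
have n0 : psi 0 != 0 by rewrite -normr_eq0 psi_norm oner_neq0.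
by apply: (mulfI n0); rewrite -psiD addr0 mulr1.
Qed.

Section Ext.
Variables (K : closedFieldType) (iota : {rmorphism F -> K}).
Local Notation hq := (pchar_nat_ext iota).
Local Notation fK := (map_poly iota f).
Local Notation psiK := (ext_char iota psi).

(** Let [N a] be the number of points of trace [a], at most [E = q ^ n + B]. As
    the values of [psi] add up to [0], the sum equals minus the sum of [psi a *
    (E - N a)], whose modulus is at most the sum of the nonnegative numbers [E
    - N a], which is [q * B]. *)
Lemma char_sum_bound n : (2 <= n)%N ->
  `|char_sum q psiK fK n.+1| <= (2 * d.+1 * q * q * q ^ (n - n./2))%:R.
Proof.
move=> n2; set m := n./2.
have fKf := fixedp_map iota f.
pose T x := \sum_(i < n.+1) fK.[x ^+ (q ^ i)].
have TE x : T x = \sum_(i < n.+1) fK.[x] ^+ (q ^ i).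
  by apply: eq_bigr => i _; rewrite (fixedp_hornerX _ _ fKf).
pose N a := count (fun x => T x == iota a) (Fq K q n.+1).
pose B := (2 * d.+1 * q * q ^ (n - m))%N.
have Nle a : (N a <= q ^ n + B)%N.
  pose s := [seq x <- Fq K q n.+1 | T x == iota a].
  (* [stepanov_bound] is used with [q ^ m] in the role of [q ^ k.+1]. *)
  have dq : coprime d.+1 q.
    rewrite coprime_sym (pnat_coprime (finField_card_pchar_nat F)) //.
    by rewrite -natf_neq0_pchar.
  have sK : size fK = d.+2 by rewrite size_map_poly.
  have m0 : (0 < m)%N by rewrite /m; lia.
  have := @stepanov_bound K q hq q_gt1 fK d.+1 sK isT dq (iota a) n m.-1 s.
  rewrite (prednK m0) => h.
  have {h} : (q ^ m * size s <= (q ^ m + 2 * d.+1 * q) * q ^ n)%N.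
    apply: h; first by rewrite /m; lia.
      by rewrite filter_uniq // (uniq_Fq hq).
    by move=> x; rewrite mem_filter mem_Fq // TE => /andP[/eqP-> /eqP->].
  have -> : ((q ^ m + 2 * d.+1 * q) * q ^ n = q ^ m * (q ^ n + B))%N.
    have e : (q ^ n = q ^ m * q ^ (n - m))%N by rewrite -expnD subnKC // /m;
      lia.
    by rewrite mulnDl mulnDr; congr (_ + _)%N; rewrite {1}e /B; lia.
  by rewrite leq_pmul2l ?expn_gt0 ?(ltnW q_gt1) // size_filter.
have Tfix x : x \in Fq K q n.+1 -> exists a, T x = iota a.
  rewrite mem_Fq // => /eqP hx; apply: fixed_iota.
  rewrite -[LHS]/(frob hq _) rmorph_sum big_ord_recr /= /T big_ord_recl addrC.
  rewrite [frob hq _](fixedp_horner _ fKf) frobX hx expr1; congr (_ + _).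
  by apply: eq_bigr => i _; rewrite [frob hq _](fixedp_horner _ fKf) frobX.
have split_sum (V : nmodType) (g : F -> V) :
    \sum_(x <- Fq K q n.+1) \sum_(a | T x == iota a) g a = \sum_a g a *+ N a.
  rewrite (exchange_big_dep xpredT) //=; apply: eq_bigr => a _.
  by rewrite big_const_seq iter_addr_0.
have sumT (V : nmodType) (g : F -> V) x a : T x = iota a ->
    \sum_(b | T x == iota b) g b = g a.
  move=> ->; rewrite (bigD1 a) ?eqxx //= big1 ?addr0 // => b.
  by rewrite (inj_eq (fmorph_inj _)) eq_sym andbC => /andP[/negPf->].
have SE : char_sum q psiK fK n.+1 = \sum_a psi a *+ N a.
  rewrite -split_sum; apply: eq_big_seq => x /Tfix[a e].
  by rewrite -/(T x) (sumT _ _ _ _ e) e ext_charE.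
have NE : (\sum_a N a = q ^ n.+1)%N.
  transitivity (\sum_a 1%N *+ N a); first by apply: eq_bigr => a _;
    rewrite natn.
  rewrite -split_sum -(size_Fq K q_gt1 (ltn0Sn n)) -sum1_size.
  by apply: eq_big_seq => x /Tfix[a e]; rewrite (sumT _ _ _ _ e).
have -> : char_sum q psiK fK n.+1 = - \sum_a psi a *+ (q ^ n + B - N a).
  rewrite SE; apply/eqP; rewrite -addr_eq0 -big_split /=.
  rewrite (eq_bigr (fun a => psi a *+ (q ^ n + B))) => [|a _]; last first.
    by rewrite -mulrnDr subnKC.
  by rewrite sumrMnl (sum_nontrivial_morphism psiD) ?mul0rn.
rewrite normrN (le_trans (ler_norm_sum _ _ _)) //.
rewrite (eq_bigr (fun a => (q ^ n + B - N a)%:R)) => [|a _]; last first.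
  by rewrite normrMn psi_norm.
rewrite -natr_sum ler_nat -(leq_add2l (\sum_a N a)) -big_split /=.
rewrite (eq_bigr (fun _ => q ^ n + B)%N) => [|a _]; last by rewrite subnKC.
rewrite sum_nat_const NE expnS mulnDr leq_add2l /B.
apply: eq_leq; rewrite mulnA; congr (_ * _)%N; exact: mulnC.
Qed.

Lemma char_sum1 : char_sum q psiK fK 1 = \sum_x psi f.[x].
Proof.
rewrite /char_sum (perm_big _ (perm_Fq1 iota)) big_image /=.
by apply: eq_bigr => x _; rewrite big_ord1 expr1 horner_map ext_charE.
Qed.

Lemma char_sum_power_bound n : (2 <= n)%N ->
  `|char_sum q psiK fK n.+1| <= (2 * d.+1 * q * q)%:R * sqrtC q%:R ^+ n.+1 :>
    R[i].
Proof.
move=> n2; apply: le_trans (char_sum_bound n2) _.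
rewrite natrM ler_wpM2l ?ler0n // natrX -{1}(sqrtCK q%:R) -exprM.
apply: ler_weXn2l; last by lia.
have h1 : 1 <= q%:R :> R[i] by rewrite ler1n ltnW.
by rewrite -[leLHS]sqrtC1 ler_sqrtC ?nnegrE ?ler01 ?ler0n.
Qed.

Lemma weil_bound_ext : `|\sum_x psi f.[x]| <= d%:R * sqrtC q%:R :> R[i].
Proof.
have sK : size fK = d.+2 by rewrite size_map_poly.
have dK : d.+1%:R != 0 :> K by rewrite -(rmorph_nat iota) fmorph_eq0.
have p0 : psiK 0 = 1 by rewrite -(rmorph0 iota) ext_charE character_at0.
have pn : exists2 c, c ^+ q = c & psiK c != 1.
  by have [b hb] := psi_nontriv; exists (iota b); rewrite ?expq_iota ?ext_charE.
have [ws sws hws] := char_sum_power_sum q_gt1 (ext_charD iota psiD) p0 pn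
  (fixedp_map iota f) sK dK.
have sq0 : 0 < sqrtC q%:R :> R[i] by rewrite sqrtC_gt0 ltr0n ltnW.
have wle w : w \in ws -> `|w| <= sqrtC q%:R.
  apply: (@power_sum_growth R ws _ (2 * d.+1 * q * q)%:R 3) => //.
  by case=> // n n2; rewrite -normrN -hws char_sum_power_bound.
rewrite -char_sum1 hws normrN (le_trans (ler_norm_sum _ _ _)) //.
rewrite -sws -sum1_size natr_sum mulr_suml big_seq [leRHS]big_seq;
  apply: ler_sum => w ws'.
by rewrite expr1 mul1r wle.
Qed.
End Ext.

Lemma weil_bound : `|\sum_x psi f.[x]| <= d%:R * sqrtC q%:R :> R[i].
Proof.
by have [K [iota _]] := countable_algebraic_closure F;
  exact: (weil_bound_ext iota).
Qed.
End Weil.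

Local Open Scope classical_set_scope.
Local Open Scope card_scope.
Local Open Scope ring_scope.

(** * Characters and polynomials of small degree *)

Section Difference.
Variable R : comNzRingType.
Implicit Types h : {poly R}.

(** Taylor's formula for [h (X + 1) - h (X)]; in this form the degree can be
    read off from the first derivative. *)
Definition poly_diff h : {poly R} := \sum_(i < (size h).-1) h^`N(i.+1).

Lemma horner_poly_diff h x : (poly_diff h).[x] = h.[x + 1] - h.[x].
Proof.
rewrite nderiv_taylor; last exact: mulrC.
rewrite /poly_diff horner_sum; case sh: (size h) => [|n] /=.
  by move/eqP: sh; rewrite size_poly_eq0 => /eqP->;
    rewrite !big_ord0 horner0 subr0.
rewrite big_ord_recl nderivn0 expr0 mulr1 addrC addKr.
by apply: eq_bigr => i _; rewrite expr1n mulr1.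
Qed.

Lemma size_nderivn_le h i : (size h^`N(i) <= size h - i)%N.
Proof.
apply/leq_sizeP => j hj; rewrite coef_nderivn nth_default ?mul0rn //.
by rewrite -leq_subLR.
Qed.

Lemma size_poly_diff h d : size h = d.+2 -> lead_coef h *+ d.+1 != 0 ->
  size (poly_diff h) = d.+1.
Proof.
move=> sh dh; rewrite /poly_diff sh big_ord_recl nderivn1.
have s1 : size h^`() = d.+1.
  apply/eqP; rewrite eqn_leq; apply/andP; split.
    by rewrite -[d.+1]/(d.+2.-1) -sh -subn1 -nderivn1 size_nderivn_le.
  rewrite ltnNge; apply: contra dh => /leq_sizeP/(_ d (leqnn d)).
  by rewrite coef_deriv /lead_coef sh => ->.
rewrite size_polyDl ?s1 // ltnS (leq_trans (size_sum _ _ _)) //.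
apply/bigmax_leqP => i _; rewrite (leq_trans (size_nderivn_le _ _)) // sh /=.
by rewrite /bump /=; lia.
Qed.
End Difference.

Section Characters.
Variables (R : realType) (F : finFieldType) (p : nat).
Hypothesis charF : p \in [pchar F].
Variable psi : F -> R[i].
Hypothesis psi_char : additive_character psi.
Hypothesis psi_nontriv : nontrivial_character psi.
Local Notation q := #|F|.
Implicit Types (f g h : {poly F}) (x y : F) (chi : F -> R[i]).

Lemma character_conj chi x : additive_character chi -> (chi x)^* = chi (- x).
Proof.
case=> chiD chi1; have c0 y : chi y != 0 by rewrite -normr_eq0 chi1 oner_neq0.
have chi0 : chi 0 = 1 by apply: (mulfI (c0 0)); rewrite -chiD addr0 mulr1.
have -> : chi (- x) = (chi x)^-1.
  by apply: (mulfI (c0 x)); rewrite -chiD subrr chi0 divff.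
by rewrite invC_norm chi1 expr1n invr1 mul1r.
Qed.

Let psiD : {morph psi : x y / x + y >-> x * y} := proj1 psi_char.

Let psi_ne1 : exists x, psi x != 1.
Proof. by case: psi_nontriv => x hx; exists x; apply/eqP. Qed.

Lemma natF_neq0 d : (0 < d < p)%N -> d%:R != 0 :> F.
Proof.
case/andP=> d0 dp; rewrite -(dvdn_pcharf charF).
by apply/negP => /(dvdn_leq d0); rewrite leqNgt dp.
Qed.

Lemma sum_character_scale c : c != 0 -> \sum_x psi (c * x) = 0.
Proof.
move=> c0; have [b hb] := psi_ne1.
apply: sum_nontrivial_morphism => [x y|]; first by rewrite mulrDr psiD.
by exists (c^-1 * b); rewrite mulVKf.
Qed.

Lemma psi_at0 : psi 0 = 1.
Proof. exact: (character_at0 psiD (proj2 psi_char)). Qed.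

Lemma sum_character_scaleE c : \sum_x psi (c * x) = q%:R *+ (c == 0).
Proof.
case: eqVneq => [->|/sum_character_scale//].
by under eq_bigr do rewrite mul0r psi_at0; rewrite sumr_const.
Qed.

(** If [psi] is constant on the values of [h], it is also constant on those of
    [h (X + 1) - h (X)]. As the degree of [h] is prime to the
    characteristic, the difference lowers it by exactly one.  This leads to a
    linear polynomial, and that one takes every value. *)
Lemma character_const_poly h : (size h <= p)%N ->
  (forall x, psi h.[x] = psi h.[0]) -> (size h <= 1)%N.
Proof.
have [d] := ubnP (size h); elim: d h => // d IH h /ltnSE hd hp hh.
rewrite leqNgt; apply/negP => h1.
have [e sh] : exists e, size h = e.+2 by exists (size h - 2)%N; lia.
have psiN x : psi (- x) = (psi x)^*  by rewrite character_conj.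
have lh : lead_coef h *+ e.+1 != 0.
  rewrite -mulr_natr mulf_neq0 ?natF_neq0 //; last by rewrite -sh.
  by rewrite lead_coef_eq0 -size_poly_eq0 sh.
have sd := size_poly_diff sh lh.
have /(IH _ _ _) sd1 : forall x, psi (poly_diff h).[x] = psi (poly_diff h).[0].
  move=> x; rewrite !horner_poly_diff !psiD !psiN [psi h.[x + 1]]hh [psi
    h.[x]]hh.
  by rewrite add0r [psi h.[1]]hh.
have : (size (poly_diff h) <= 1)%N by apply: sd1; rewrite sd -?sh //; lia.
rewrite sd ltnS leqn0 => /eqP e0; rewrite e0 in sh lh.
have hE x : h.[x] = lead_coef h * x + h.[0].
  rewrite /lead_coef sh horner_coef sh !big_ord_recl big_ord0 horner_coef0.
  by rewrite expr0 mulr1 addr0 expr1 addrC.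
have l0 : lead_coef h != 0 by move: lh; rewrite mulr1n.
have [b /eqP[]] := psi_ne1.
have n0 : psi h.[0] != 0 by rewrite -normr_eq0 (proj2 psi_char) oner_neq0.
apply: (mulIf n0); rewrite mul1r -psiD -[b](mulVKf l0) -hE; exact: hh.
Qed.

Lemma Spoly_sub_eq0 r h : Spoly F r h -> (size h <= 1)%N -> h = 0.
Proof.
case=> h0 _ /size1_polyC e; move: h0; rewrite e hornerC => ->.
by rewrite polyC0.
Qed.

Lemma SpolyB r f g : Spoly F r f -> Spoly F r g -> Spoly F r (f - g).
Proof.
case=> f0 sf [g0 sg]; split; first by rewrite hornerD hornerN f0 g0 subr0.
by rewrite (leq_trans (size_polyD _ _)) // size_polyN geq_max sf.
Qed.

Lemma sqrtq_gt0 : 0 < sqrtq R F.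
Proof. by rewrite sqrtC_gt0 ltr0n ltnW ?finRing_gt1. Qed.

Lemma sqrtq_mul : sqrtq R F * sqrtq R F = q%:R.
Proof. by rewrite -expr2 sqrtCK. Qed.

Lemma conj_sqrtq : ((sqrtq R F)^-1)^* = (sqrtq R F)^-1.
Proof. by apply/CrealP; rewrite rpredV ger0_real // ltW // sqrtq_gt0. Qed.

Lemma phi_inj r f g : (r < p)%N -> Spoly F r f -> Spoly F r g ->
  phi psi f = phi psi g -> f = g.
Proof.
move=> rp Sf Sg e; apply/eqP; rewrite -subr_eq0; apply/eqP.
have Sfg := SpolyB Sf Sg; apply: (Spoly_sub_eq0 Sfg).
have fg x : psi f.[x] = psi g.[x].
  have := congr1 (fun u : cvec R F => u x) e; rewrite !ffunE.
  by apply: mulfI; rewrite invr_eq0 gt_eqF ?sqrtq_gt0.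
have one x : psi (f - g).[x] = 1.
  rewrite hornerD hornerN psiD fg -(character_conj _ psi_char) -normCK.
  by rewrite (proj2 psi_char) expr1n.
apply: character_const_poly => [|x]; last by rewrite !one.
by case: Sfg => _ /leq_trans-> .
Qed.

Lemma inner_phi f g :
  inner (phi psi f) (phi psi g) = q%:R^-1 * \sum_x psi (f - g).[x] :> R[i].
Proof.
rewrite /inner mulr_sumr; apply: eq_bigr => x _.
rewrite !ffunE rmorphM /= conj_sqrtq character_conj // mulrACA -invfM sqrtq_mul.
by rewrite -psiD hornerD hornerN.
Qed.

Lemma card_phi_Spoly r : (r < p)%N -> (phi psi @` Spoly F r) #= `I_(q ^ r).
Proof.
move=> rp; have cq : (q ^ r)%N = #|{: 'rV[F]_r}| by rewrite card_mx mul1n.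
pose P (c : 'rV[F]_r) : {poly F} := 'X * rVpoly c.
have SP c : Spoly F r (P c).
  split; first by rewrite /P hornerM hornerX mul0r.
  by rewrite /P mulrC (leq_trans (size_polyMleq _ _)) // size_polyX addn2 ltnS
    /rVpoly size_poly.
have -> : phi psi @` Spoly F r =
    (fun i : 'I_#|{: 'rV[F]_r}| => phi psi (P (enum_val i))) @` setT.
  apply/seteqP; split => [_ [f [f0 sf] <-]|_ [i _ <-]];
    last by exists (P (enum_val i)).
  have [g Dg] : exists g, f = 'X * g.
    have : root f 0 by rewrite /root f0.
    by case/factor_theorem => g ->; exists g; rewrite subr0 mulrC.
  have sg : (size g <= r)%N.
    have [->|g0] := eqVneq g 0; first by rewrite size_poly0.
    by move: sf; rewrite Dg mulrC size_mulX // ltnS.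
  exists (enum_rank (poly_rV g : 'rV[F]_r)) => //.
  by rewrite enum_rankK /P poly_rV_K // Dg.
rewrite cq; apply: card_eq_trans (inj_card_eq _) _;
  last by rewrite card_eq_sym card_II.
move=> i j _ _ /= /(phi_inj rp (SP _) (SP _)) /(mulfI (negbT (polyX_eq0 F))) e.
by apply: enum_val_inj; apply: (can_inj (@rVpolyK F r)).
Qed.

(** Summed over [c], the inner products of [chi] with the characters [psi (c *
    x)] give [q * chi 0], so one of them is nonzero; then the quotient of the
    two characters is trivial. *)
Lemma phi_linear_characters :
  phi psi @` Spoly F 1 = scaled (F := F) @` [set chi | additive_character chi].
Proof.
apply/seteqP; split => [_ [f [f0 sf] <-]|_ [chi hchi <-]].
  exists (fun x => psi f.[x]) => //=.
  have fE x : f.[x] = f`_1 * x.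
    by rewrite (horner_coef_wide _ sf) !big_ord_recl big_ord0 /= -horner_coef0
      f0 !addr0 mul0r add0r expr1.
  split=> [x y|x]; last by case: psi_char => _ ->.
  by rewrite !fE mulrDr psiD.
have [c hc] : exists c, \sum_x chi x * psi (- (c * x)) != 0.
  apply/existsP; apply: contraT => /existsPn h.
  have : \sum_c \sum_x chi x * psi (- (c * x)) = 0.
    by apply: big1 => c _; apply/eqP; rewrite -[_ == _]negbK h.
  rewrite exchange_big /= (bigD1 0) //= [X in _ + X]big1 => [|x x0]; last first.
    rewrite /= -mulr_sumr (eq_bigr (fun c => psi (- x * c))) => [|c _].
      by rewrite sum_character_scale ?mulr0 // oppr_eq0.
    by rewrite mulNr mulrC.
  under eq_bigr do rewrite mulr0 oppr0 psi_at0 mulr1.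
  rewrite addr0 sumr_const => /eqP; rewrite mulrn_eq0 -normr_eq0 (proj2 hchi).
  by rewrite oner_eq0 orbF -[_ == _]negbK -lt0n (ltnW (finRing_gt1 F)).
pose eta x := chi x * psi (- (c * x)).
have etaD : {morph eta : x y / x + y >-> x * y}.
  by move=> x y; rewrite /eta (proj1 hchi) mulrDr opprD psiD mulrACA.
have eta1 x : eta x = 1.
  apply/eqP; apply: contraNT hc => hx; apply/eqP.
  by apply: sum_nontrivial_morphism etaD _; exists x.
exists (c *: 'X).
  split; first by rewrite hornerZ hornerX mulr0.
  by rewrite (leq_trans (size_scale_leq _ _)) // size_polyX.
apply/ffunP => x; rewrite !ffunE hornerZ hornerX; congr (_ * _).
have n0 : psi (- (c * x)) != 0 by rewrite -normr_eq0 (proj2 psi_char) oner_neq0.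
by apply: (mulIf n0); rewrite -psiD subrr psi_at0 -(eta1 x).
Qed.

Lemma inner_phi_bound r f g : (r < p)%N -> Spoly F r f -> Spoly F r g ->
  f <> g ->
  `|inner (phi psi f) (phi psi g)| <= (r%:R - 1) / sqrtq R F.
Proof.
move=> rp Sf Sg fg; have Sh := SpolyB Sf Sg; set h := f - g in Sh.
have h0 : h != 0 by rewrite subr_eq0; apply/eqP.
have h1 : (1 < size h)%N.
  by rewrite ltnNge; apply: contra h0 => /(Spoly_sub_eq0 Sh)/eqP.
have [d sh] : exists d, size h = d.+2 by exists (size h - 2)%N; lia.
have dr : (d < r)%N by case: Sh => _; rewrite sh.
have dF : d.+1%:R != 0 :> F by rewrite natF_neq0 // (leq_ltn_trans dr).
have W := weil_bound psiD (proj2 psi_char) psi_ne1 sh dF.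
have s0 := sqrtq_gt0; have s1 := gt_eqF s0.
rewrite inner_phi normrM normfV normr_nat -/h -sqrtq_mul invfM mulrC mulrA.
rewrite ler_pM2r ?invr_gt0 // ler_pdivrMr // (le_trans W) //.
by rewrite ler_pM2r // lerBrDr natr1 ler_nat.
Qed.
End Characters.

(** * Orthonormal bases and quadratic polynomials *)

Section OrthonormalBases.
Variables (R : realType) (F : finFieldType).
Local Notation q := #|F|.

Lemma orthonormal_tuple_basis (s : q.-tuple (cvec R F)) :
  (forall i j, inner (tnth s i) (tnth s j) = (i == j)%:R) ->
  orthonormal_basis [set` s].
Proof.
move=> ort; exists s; split=> //.
have dimE : dim (cvec R F) = q by rewrite /dim /= muln1.
rewrite basisEfree subvf dimvf dimE size_tuple leqnn !andbT.
apply/freeP => k k0 i.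
have := congr1 (fun u : cvec R F => inner u (tnth s i)) k0.
have -> : inner (\sum_(j < q) k j *: s`_j) (tnth s i) =
    \sum_j k j * inner (tnth s j) (tnth s i).
  rewrite /inner; under [RHS]eq_bigr do rewrite mulr_sumr.
  rewrite exchange_big; apply: eq_bigr => x _ /=.
  rewrite sum_ffunE mulr_suml; apply: eq_bigr => j _.
  by rewrite !ffunE mulrA -tnth_nth.
rewrite (bigD1 i) //= ort eqxx mulr1 big1 ?addr0 => [->|j ji].
  by rewrite /inner big1 // => x _; rewrite ffunE mul0r.
by rewrite ort (negPf ji) mulr0.
Qed.

Lemma inner_sym (u v : cvec R F) : inner u v = (inner v u)^*.
Proof.
rewrite /inner rmorph_sum; apply: eq_bigr => x _.
by rewrite rmorphM /= conjCK mulrC.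
Qed.

Lemma norm_inner_sym (u v : cvec R F) : `|inner u v| = `|inner v u|.
Proof. by rewrite inner_sym norm_conjC. Qed.

Lemma inner_delta (u : cvec R F) a :
  inner u [ffun x => (x == a)%:R] = u a.
Proof.
rewrite /inner (bigD1 a) //= ffunE eqxx conjC1 mulr1 big1 ?addr0 // => x xa.
by rewrite ffunE (negPf xa) conjC0 mulr0.
Qed.

Lemma identity_basis_orthonormal : orthonormal_basis (identity_basis R F).
Proof.
pose e a : cvec R F := [ffun x => (x == a)%:R].
have -> : identity_basis R F = [set` [tuple e (enum_val i) | i < q]].
  apply/seteqP; split => [_ [a _ <-]|u] /=.
    by apply/mapP; exists (enum_rank a); rewrite ?mem_enum // enum_rankK.
  by case/mapP => i _ ->; exists (enum_val i).
apply: orthonormal_tuple_basis => i j; rewrite !tnth_mktuple inner_delta ffunE.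
by rewrite (inj_eq enum_val_inj) eq_sym.
Qed.
End OrthonormalBases.

Section Quadratic.
Variables (R : realType) (F : finFieldType) (p : nat).
Hypothesis charF : p \in [pchar F].
Hypothesis p_gt2 : (2 < p)%N.
Variable psi : F -> R[i].
Hypothesis psi_char : additive_character psi.
Hypothesis psi_nontriv : nontrivial_character psi.
Local Notation q := #|F|.

Definition quad (a b : F) : {poly F} := a *: 'X^2 + b *: 'X.

Lemma horner_quad a b x : (quad a b).[x] = a * x ^+ 2 + b * x.
Proof. by rewrite /quad !hornerE. Qed.

Lemma quad_Spoly a b : Spoly F 2 (quad a b).
Proof.
split; first by rewrite horner_quad expr0n !mulr0 addr0.
rewrite (leq_trans (size_polyD _ _)) // geq_max.
by rewrite !(leq_trans (size_scale_leq _ _)) ?size_polyX ?size_polyXn.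
Qed.

Lemma Spoly2_quad f : Spoly F 2 f -> f = quad f`_2 f`_1.
Proof.
case=> f0 sf; apply/polyP => i; rewrite /quad coefD !coefZ coefXn coefX.
case: i => [|[|[|i]]] /=; rewrite ?mulr0 ?mulr1 ?addr0 ?add0r //.
  by rewrite -horner_coef0.
by rewrite nth_default // (leq_trans sf).
Qed.

Lemma quad_coef a b : ((quad a b)`_2 = a) * ((quad a b)`_1 = b).
Proof.
by rewrite /quad !coefD !coefZ !coefXn !coefX /= !mulr0 !mulr1 addr0 add0r.
Qed.

Definition quad_basis (a : F) : set (cvec R F) := range (fun b =>
  phi psi (quad a b)).

Lemma inner_quad a b a' b' :
  inner (phi psi (quad a b)) (phi psi (quad a' b')) =
  q%:R^-1 * \sum_x psi ((a - a') * x ^+ 2 + (b - b') * x).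
Proof.
rewrite inner_phi //; congr (_ * _); apply: eq_bigr => x _; congr psi.
by rewrite hornerD hornerN !horner_quad; ring.
Qed.

Lemma quad_basis_orthonormal a : orthonormal_basis (quad_basis a).
Proof.
have -> : quad_basis a = [set` [tuple phi psi (quad a (enum_val i)) | i < q]].
  apply/seteqP; split => [_ [b _ <-]|u] /=.
    by apply/mapP; exists (enum_rank b); rewrite ?mem_enum // enum_rankK.
  by case/mapP => i _ ->; exists (enum_val i).
apply: orthonormal_tuple_basis => i j; rewrite !tnth_mktuple inner_quad subrr.
under eq_bigr do rewrite mul0r add0r.
rewrite sum_character_scaleE // subr_eq0 (inj_eq enum_val_inj).
case: (i == j); rewrite ?mulr0 // mulVf //.
by rewrite pnatr_eq0 -lt0n ltnW ?finRing_gt1.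
Qed.

(** Put [x = y + t] in the square of the modulus: for a fixed [t] the exponent
    is linear in [y], with slope [2 * a * t], so only [t = 0] contributes. *)
Lemma quadratic_sum_norm a b : a != 0 ->
  `|\sum_x psi (a * x ^+ 2 + b * x)| = sqrtq R F.
Proof.
move=> a0; apply/eqP.
rewrite -(eqrXn2 (isT : (0 < 2)%N)) ?normr_ge0 ?(ltW (sqrtq_gt0 _ _)) //.
rewrite [sqrtq R F ^+ 2]expr2 sqrtq_mul normCK rmorph_sum mulr_sumr /=.
have psiD := proj1 psi_char.
transitivity (\sum_t psi (a * t ^+ 2 + b * t) * \sum_y psi (2 * a * t * y) ==
  q%:R); last first.
  have n2 : 2 != 0 :> F by rewrite (natF_neq0 charF).
  rewrite (bigD1 0) //= [X in _ + X]big1 => [|t t0]; last first.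
    by rewrite (sum_character_scale psi_char psi_nontriv) ?mulr0 // !mulf_neq0.
  rewrite expr0n !mulr0 !addr0 (psi_at0 psi_char) mul1r.
  under eq_bigr do rewrite mul0r (psi_at0 psi_char).
  by rewrite sumr_const eqxx.
congr (_ == _).
under eq_bigr => y _.
  rewrite mulr_suml (reindex (+%R y)) /=; last first.
    by exists (+%R (- y)) => x _; rewrite ?addKr ?addNKr.
  over.
rewrite exchange_big /=; apply: eq_bigr => t _; rewrite mulr_sumr.
apply: eq_bigr => y _; rewrite (character_conj _ psi_char) -!psiD; congr psi.
by ring.
Qed.

Lemma mutually_unbiased_quad_bases :
  exists B : 'I_#|F| -> set (cvec R F),
    [/\ partition [set: 'I_#|F|] B (phi psi @` Spoly F 2),
        forall i, orthonormal_basis (B i) &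
        mutually_unbiased
          (fun o => if o is Some i then B i else identity_basis R F)].
Proof.
pose B (i : 'I_#|F|) := quad_basis (enum_val i).
have s0 := sqrtq_gt0 R F.
have delta_phi a f : `|inner (phi psi f) [ffun x =>
  (x == a)%:R]| = 1 / sqrtq R F.
  rewrite inner_delta !ffunE normrM (proj2 psi_char) mulr1 div1r ger0_norm //.
  by rewrite invr_ge0 ltW.
exists B; split.
- split.
  + apply/seteqP; split => [_ [i _ [b _ <-]]|_ [f /Spoly2_quad-> <-]].
      by exists (quad (enum_val i) b) => //; exact: quad_Spoly.
    by exists (enum_rank f`_2) => //; rewrite /B enum_rankK; exists f`_1.
  + move=> i j _ _ [u [[b _ <-] [b' _ e]]]; apply: enum_val_inj.
    have := phi_inj charF psi_char psi_nontriv p_gt2 (quad_Spoly _ _)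
      (quad_Spoly _ _) e.
    by move/(congr1 (fun f : {poly F} => f`_2)); rewrite !quad_coef.
  + by move=> i _; exists (phi psi (quad (enum_val i) 0)); exists 0.
- by move=> i; exact: quad_basis_orthonormal.
split=> [[i|]|[i|] [j|] //].
- exact: quad_basis_orthonormal.
- exact: identity_basis_orthonormal.
- move=> ij _ _ [b _ <-] [b' _ <-];
  rewrite inner_quad normrM quadratic_sum_norm.
    rewrite normfV normr_nat -sqrtq_mul invfM mulfVK ?div1r // gt_eqF //.
  by rewrite subr_eq0 (inj_eq enum_val_inj); apply/eqP => e; apply: ij;
    rewrite e.
- by move=> _ _ _ [b _ <-] [a _ <-]; rewrite delta_phi.
- by move=> _ _ _ [a _ <-] [b _ <-]; rewrite norm_inner_sym delta_phi.
Qed.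
End Quadratic.

Theorem theorem9 (R : realType) (F : finFieldType) (p : nat)
    (charF : p \in [pchar F]) (psi : F -> R[i])
    (psi_char : additive_character psi)
    (psi_nontriv : nontrivial_character psi) :
  [/\
    (forall r, (0 < r)%N -> (r.+1 < p)%N -> Spoly F r `<=` Spoly F r.+1) /\
    (forall r, (0 < r)%N -> (r < p)%N ->
       (phi psi @` Spoly F r) #= `I_(#|F| ^ r)),
    phi psi @` Spoly F 1 = scaled (F := F) @` [set chi | additive_character chi],
    (2 < p)%N ->
      exists B : 'I_#|F| -> set (cvec R F),
        [/\ partition [set: 'I_#|F|] B (phi psi @` Spoly F 2),
            forall i, orthonormal_basis (B i) &
            mutually_unbiased
              (fun o => if o is Some i then B i else identity_basis R F)] &
    forall r, (0 < r)%N -> (r < p)%N ->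
      forall f g, Spoly F r f -> Spoly F r g -> f <> g ->
        `|inner (phi psi f) (phi psi g)| <= (r%:R - 1) / sqrtq R F ].
Proof.
split.
- split=> r r0 rp; first by move=> f [f0 sf]; split=> //; exact: leqW.
  exact: (card_phi_Spoly charF psi_char psi_nontriv rp).
- exact: phi_linear_characters.
- by move=> p2; exact: (mutually_unbiased_quad_bases charF p2 psi_char
  psi_nontriv).
- move=> r r0 rp f g Sf Sg fg.
  exact: (inner_phi_bound charF psi_char psi_nontriv rp Sf Sg fg).
Qed.
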